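(* Let $1\le q<\infty$ and $\omega\ge 0$, and let $A$ be an operator on $L^{q}(\Sigma,\mu)$ with dense domain such that $A+\omega I$ is $m$-completely accretive in $L^{q}(\Sigma,\mu)$. Suppose that there are $1\le r\le\infty$, $\varrho\ge 0$, $\sigma>0$ and $C>0$ such that $$\|u-\hat u\|_{r}^{\sigma}\le C\,\Big([u-\hat u,v-\hat v]_{q}+\omega\|u-\hat u\|_{q}^{q}\Big)\,\|u-\hat u\|_{q}^{\varrho}\qquad\text{for every }(u,v),(\hat u,\hat v)\in A .$$ Then the semigroup $\{T_t\}_{t\ge0}$ generated by $-A$ on $L^{q}(\Sigma,\mu)$ satisfies $$\|T_tu-T_t\hat u\|_{r}\le \Big(\tfrac{C}{q}\Big)^{1/\sigma}t^{-\alpha}e^{\omega\beta t}\|u-\hat u\|_{q}^{\gamma}$$ for every $t>0$ and $u,\hat u\in L^{q}(\Sigma,\mu)$, with $\alpha=\frac1\sigma$, $\beta=\gamma+1$, $\gamma=\frac{q+\varrho}{\sigma}$. Moreover, if $1\le r<\infty$, $\gamma r>q$ and there is $(u_0,0)\in A$ for some $u_0\in L^{1}\cap L^{\infty}(\Sigma,\mu)$, then for every $m_0\ge q\gamma^{-1}$ satisfying $$\Big(\tfrac{\gamma r}{q}-1\Big)m_0+q\Big(\tfrac1\gamma-1\Big)>0$$ and every $1\le s\le \gamma r q^{-1}m_0$ satisfying $\gamma^{*}\big(1-\frac{sq}{\gamma r m_0}\big)<1$, one has $$\|T_tu-T_t\hat u\|_{\infty}\lesssim t^{-\alpha_s}e^{\omega\beta_s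 t}\|u-\hat u\|_{s}^{\gamma_s}$$ for every $t>0$ and $u,\hat u\in L^{s}(\Sigma,\mu)$, with exponents $$\alpha^{*}=\tfrac{\sigma^{-1}q\gamma^{-1}}{(\frac{\gamma r}{q}-1)m_0+q(\frac1\gamma-1)},\quad \beta^{*}=\tfrac{\gamma^{2}rq^{-1}-1}{(\frac{\gamma r}{q}-1)m_0+q(\frac1\gamma-1)}+1,\quad \gamma^{*}=\tfrac{(\gamma rq^{-1}-1)m_0}{(\frac{\gamma r}{q}-1)m_0+q(\frac1\gamma-1)},$$ $$\alpha_s=\tfrac{\alpha^{*}}{1-\gamma^{*}(1-\frac{sq}{\gamma r m_0})},\quad \beta_s=\tfrac{\beta^{*}2^{-1}+\gamma^{*}\frac{sq}{\gamma r m_0}}{1-\gamma^{*}(1-\frac{sq}{\gamma r m_0})},\quad \gamma_s=\tfrac{\gamma^{*}\frac{sq}{\gamma r m_0}}{1-\gamma^{*}(1-\frac{sq}{\gamma r m_0})}.$$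
   Context: $(\Sigma,\mu)$ is a $\sigma$-finite measure space; functions are real-valued; $\|\cdot\|_q$ is the norm of $L^q(\Sigma,\mu)$. An operator $A$ on $L^{q}(\Sigma,\mu)$ is a subset $A\subseteq L^q\times L^q$ (possibly multi-valued), with domain $D(A)=\{u: Au\ne\emptyset\}$ and range $Rg(A)$. The $q$-bracket is $[u,v]_q=\int_\Sigma |u|^{q-2}u\,v\,d\mu$ if $1<q<\infty$, and $[u,v]_1=\int_{\{u\ne0\}}\mathrm{sign}(u)\,v\,d\mu+\int_{\{u=0\}}|v|\,d\mu$. Let $\mathcal J_0$ be the set of convex, lower semicontinuous $j:\mathbb R\to[0,\infty]$ with $j(0)=0$. An operator $B$ is completely accretive if for every $\lambda>0$ the resolvent $J_\lambda=(I+\lambda B)^{-1}$ is a single-valued map on $Rg(I+\lambda B)$ with $\int_\Sigma j(J_\lambda u-J_\lambda\hat u)\,d\mu\le\int_\Sigma j(u-\hat u)\,d\mu$ for all $j\in\mathcal J_0$ and all $u,\hat u\in Rg(I+\lambda B)$. It is $m$-completely accretive in $L^q$ if, in addition, $Rg(I+\lambda B)=L^q(\Sigma,\mu)$ for some (equivalently all) $\lambda>0$. If $A+\omega I$ is $m$-completely accretive in $L^q$, the semigroup generated by $-A$ is $T_tu=\lim_{n\to\infty}(I+\frac tnA)^{-n}u$ in $L^q$, $u\in\overline{D(A)}$. Each $T_t$ is Lipschitz with constant $e^{\omega t}$ with respect to every $L^{s}$-norm; for $u\in L^s(\Sigma,\mu)$, $T_tu$ denotes the value of the unique Lipschitz continuous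 extension of $T_t$ to $L^s(\Sigma,\mu)$. The symbol $\lesssim$ means inequality up to a multiplicative constant independent of $t,u,\hat u$. *)

(* Defs.v *)
From HB Require Import structures.
From mathcomp Require Import all_boot all_order all_algebra.
From mathcomp Require Import all_classical all_reals all_analysis.

Set Implicit Arguments.
Unset Strict Implicit.
Unset Printing Implicit Defensive.
Import Order.TTheory GRing.Theory Num.Theory.
Import numFieldNormedType.Exports.

Local Open Scope classical_set_scope.
Local Open Scope ring_scope.

(* [LspaceType mu p1] is the quotient of the measurable functions with finite
   [p]-norm by a.e. equality; it carries no algebraic structure, so sums and
   differences of classes are formed on representatives and compared with
   [%[ae mu]]. *)

Definition Ldist (d : measure_display) (T : measurableType d) (R : realType)
    (mu : {measure set T -> \bar R}) (p : \bar R) (u v : T -> R) : \bar R :=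
  ('N[mu]_p[EFin \o (u \- v)%R])%E.

(* Where [u x = 0] the last integrand is [0] whatever the value of [0 `^ (q - 2)]. *)
Definition qbracket (d : measure_display) (T : measurableType d) (R : realType)
    (mu : {measure set T -> \bar R}) (q : R) (u v : T -> R) : R :=
  if q == 1 then
    \int[mu]_(x in [set x | u x != 0]) (Num.sg (u x) * v x)
    + \int[mu]_(x in [set x | u x = 0]) `|v x|
  else \int[mu]_x (`|u x| `^ (q - 2) * u x * v x).

(* The library's [convex_function] is restricted to real-valued functions.
   The endpoints of the interval cause no trouble because [0 * +oo = 0]. *)
Definition econvex (R : realType) (j : R -> \bar R) : Prop :=
  forall (x y a : R), 0 <= a <= 1 ->
    (j (a * x + (1 - a) * y)%R <= a%:E * j x + (1 - a)%:E * j y)%E.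

Definition J0 (R : realType) : set (R -> \bar R) :=
  [set j | [/\ econvex j, lower_semicontinuous j,
               forall x, (0 <= j x)%E & j 0 = 0%E]].

Definition Lop (d : measure_display) (T : measurableType d) (R : realType)
    (mu : {measure set T -> \bar R}) (p : \bar R) (p1 : (1 <= p)%E) : Type :=
  set (LspaceType mu p1 * LspaceType mu p1).

Definition Ldom (d : measure_display) (T : measurableType d) (R : realType)
    (mu : {measure set T -> \bar R}) (p : \bar R) (p1 : (1 <= p)%E)
    (A : Lop mu p1) : set (LspaceType mu p1) :=
  [set u | exists v, A (u, v)].

Definition Lclosure (d : measure_display) (T : measurableType d) (R : realType)
    (mu : {measure set T -> \bar R}) (p : \bar R) (p1 : (1 <= p)%E)
    (S : set (LspaceType mu p1)) : set (LspaceType mu p1) :=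
  [set u | forall e : R, 0 < e ->
     exists2 w : LspaceType mu p1, S w & (Ldist mu p u w < e%:E)%E].

(* [A + w I]. *)
Definition Lshift (d : measure_display) (T : measurableType d) (R : realType)
    (mu : {measure set T -> \bar R}) (p : \bar R) (p1 : (1 <= p)%E)
    (A : Lop mu p1) (w : R) : Lop mu p1 :=
  [set uz : LspaceType mu p1 * LspaceType mu p1 |
     exists2 v : LspaceType mu p1, A (uz.1, v) &
     (uz.2 : T -> R) = (fun x => v x + w * uz.1 x) %[ae mu]].

(* [resolvent B l f u] is [u \in (I + l B)^-1 f]; thus [f] lies in the range of
   [I + l B] iff [resolvent B l f] is nonempty. *)
Definition resolvent (d : measure_display) (T : measurableType d) (R : realType)
    (mu : {measure set T -> \bar R}) (p : \bar R) (p1 : (1 <= p)%E)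
    (B : Lop mu p1) (l : R) (f : LspaceType mu p1) : set (LspaceType mu p1) :=
  [set u | exists2 v : LspaceType mu p1, B (u, v) &
     (f : T -> R) = (fun x => u x + l * v x) %[ae mu]].

Definition completely_accretive (d : measure_display) (T : measurableType d)
    (R : realType) (mu : {measure set T -> \bar R}) (p : \bar R)
    (p1 : (1 <= p)%E) (B : Lop mu p1) : Prop :=
  forall l : R, 0 < l ->
    (forall f u u' : LspaceType mu p1,
       resolvent B l f u -> resolvent B l f u' -> u = u') /\
    (forall f f' u u' : LspaceType mu p1,
       resolvent B l f u -> resolvent B l f' u' ->
       forall j : R -> \bar R, J0 j ->
         (\int[mu]_x j (u x - u' x)%R <= \int[mu]_x j (f x - f' x)%R)%E).

Definition m_completely_accretive (d : measure_display) (T : measurableType d)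
    (R : realType) (mu : {measure set T -> \bar R}) (p : \bar R)
    (p1 : (1 <= p)%E) (B : Lop mu p1) : Prop :=
  completely_accretive B /\
  exists2 l : R, 0 < l & forall f : LspaceType mu p1, resolvent B l f !=set0.

Fixpoint resolvent_iter (d : measure_display) (T : measurableType d)
    (R : realType) (mu : {measure set T -> \bar R}) (p : \bar R)
    (p1 : (1 <= p)%E) (A : Lop mu p1) (l : R) (n : nat)
    (f : LspaceType mu p1) : set (LspaceType mu p1) :=
  if n is m.+1
  then [set u | exists2 g, resolvent_iter A l m f g & resolvent A l g u]
  else [set f].

(* [T_t u = lim_n (I + (t/n) A)^-n u]; the iterates are only required to be
   defined for large [n] because, when [A + w I] is m-accretive, the resolvent
   is everywhere defined (and single-valued) only once [w * t / n < 1].  The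
   time [t = 0] is separate because [I + 0 A] is defined on the domain of [A]
   only. Nothing is required outside the closure of that domain. *)
Definition semigroup_generated (d : measure_display) (T : measurableType d)
    (R : realType) (mu : {measure set T -> \bar R}) (p : \bar R)
    (p1 : (1 <= p)%E) (A : Lop mu p1)
    (S : R -> LspaceType mu p1 -> LspaceType mu p1) : Prop :=
  forall u : LspaceType mu p1, Lclosure (Ldom A) u ->
    S 0 u = u /\
    forall t : R, 0 < t ->
      exists2 w : nat -> LspaceType mu p1,
        \forall n \near \oo, resolvent_iter A (t / n%:R) n u (w n) &
        Ldist mu p (w n) (S t u) @[n --> \oo] --> 0%E.

Definition Lipschitz_extension (d : measure_display) (T : measurableType d)
    (R : realType) (mu : {measure set T -> \bar R})
    (p : \bar R) (p1 : (1 <= p)%E) (s : \bar R) (s1 : (1 <= s)%E)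
    (F : LspaceType mu p1 -> LspaceType mu p1)
    (G : LspaceType mu s1 -> LspaceType mu s1) : Prop :=
  (exists L : R, forall u u' : LspaceType mu s1,
     (Ldist mu s (G u) (G u') <= L%:E * Ldist mu s u u')%E) /\
  (forall (u : LspaceType mu p1) (u' : LspaceType mu s1),
     (u : T -> R) = (u' : T -> R) %[ae mu] ->
     (F u : T -> R) = (G u' : T -> R) %[ae mu]).

(* Main.v *)
Require Import Defs.
From HB Require Import structures.
From mathcomp Require Import all_boot all_order all_algebra.
From mathcomp Require Import all_classical all_reals all_analysis.
From mathcomp Require Import measurable_realfun ess_sup_inf ring lra.

Set Implicit Arguments.
Unset Strict Implicit.
Unset Printing Implicit Defensive.
Import Order.TTheory GRing.Theory Num.Theory.
Import numFieldNormedType.Exports.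

Local Open Scope classical_set_scope.
Local Open Scope ring_scope.

(* The resolvents of A are contractions for every L^s-distance, up to the factor
   (1 - omega h)^-1, and so are their limits T_t up to e^(omega t).

   Smoothing L^q -> L^r: along the implicit Euler scheme of step h the quantities
   (1 - omega q h)^k ||w_k||_q^q (w_k the difference of two solutions) decrease by
   at least a multiple of h ||w_k||_r^sigma, by the convexity of |.|^q and the
   Gagliardo-Nirenberg hypothesis; telescope, bound ||w_k||_r below by ||w_n||_r,
   and pass to the limit.

   L^s -> L^oo: a De Giorgi iteration.  Clip the difference u - u' at level L/2, so
   that v := u' + clip (u - u') is L/2-close to u' in L^oo, while the L^q-norm of
   u - v is controlled by a power > 1 of norms of u - u'.  Run the flow for time
   t/2 on (u, v), which costs a smoothing estimate, and repeat with (t/2, L/2).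
   Since kappa := gamma r / q > 1, the L^q-norms tend to 0 as soon as the first one
   is below a threshold; hence T_t u' is within e^(omega t) L of T_t u in L^oo.
   Optimising L bounds N(t) := ||T_t u - T_t u'||_oo by a power g < 1 of
   ||u - u'||_oo; inserting this into itself through t = t/M + (1 - 1/M) t removes
   the L^oo-norm from the right-hand side, and a large M makes the exponential rate
   as close to gamma_s as desired.  Now betastar > 0 yields gamma_s < beta_s. *)

(** * Lebesgue classes and norms *)

Section Lspace_representatives.
Context d (T : measurableType d) (R : realType) (mu : {measure set T -> \bar R}).
Context (p : \bar R) (p1 : (1 <= p)%E).

Lemma Lspace_measurable (u : LspaceType mu p1) : measurable_fun setT (u : T -> R).
Proof.
exact: (@measurable_funPT _ _ T (measurableTypeR R) (repr (u : {mfun_ mu, T >-> measurableTypeR R}))).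
Qed.

(** A class is a quotient element packed with a proof that its norm is finite: the former are equal
    by the definition of the quotient, the latter by proof irrelevance. *)
Lemma Lspace_ae_inj (u v : LspaceType mu p1) : (u : T -> R) = v %[ae mu] -> u = v.
Proof.
move=> uv.
have : (u : {mfun_ mu, T >-> measurableTypeR R}) = v :> {mfun_ mu, T >-> measurableTypeR R}.
  by rewrite -[LHS]reprK -[RHS]reprK; apply/eqP; rewrite eqmodE; exact/asboolP.
move: u v {uv} => [u [[cu]]] [v [[cv]]] /= uv.
by subst v; rewrite (Prop_irrelevance cu cv).
Qed.

Lemma Lnorm_ae (f g : T -> R) : measurable_fun setT f -> measurable_fun setT g ->
  f = g %[ae mu] -> ('N[mu]_p[EFin \o f] = 'N[mu]_p[EFin \o g])%E.
Proof.
move=> mf mg fg; rewrite Lnorm.unlock; case: p p1 => [r _|_|//]; last first.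
  case: ifP => // _; apply: eq_ess_sup.
  by apply: filterS fg => x /= ->.
have mpow (h : T -> R) : measurable_fun setT h ->
    measurable_fun setT (fun x => (`|h x| `^ r)%:E).
  move=> mh; apply/measurable_EFinP; apply: (measurableT_comp (measurable_powR _)).
  exact: measurableT_comp.
apply: (congr1 (fun z : \bar R => poweR z r^-1)).
apply: ae_eq_integral; [by []|exact: mpow|exact: mpow|].
by apply: filterS fg => x /= h _; rewrite h.
Qed.

(** Turns functions built pointwise (sums, clips, cut-offs) back into classes; the representative
    chosen by the quotient may differ from [f] on a null set. *)
Lemma Lspace_surj (f : T -> R) : measurable_fun setT f -> finite_norm mu p f ->
  exists u : LspaceType mu p1, (u : T -> R) = f %[ae mu].
Proof.
move=> mf ff.
have mf' : @measurable_fun _ _ T (measurableTypeR R) setT f by exact: mf.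
pose g : {mfun T >-> measurableTypeR R} :=
  HB.pack f (@isMeasurableFun.Build _ _ T (measurableTypeR R) f mf').
pose h : {mfun_ mu, T >-> measurableTypeR R} :=
  (\pi_({mfun_ mu, T >-> measurableTypeR R}) g)%qT.
have hf : (h : T -> R) = f %[ae mu].
  have : repr h = g %[mod {mfun_ mu, T >-> measurableTypeR R}]%qT by rewrite reprK.
  by move/eqP; rewrite eqmodE => /asboolP.
have hfin : finite_norm mu p h.
  rewrite /finite_norm (@Lnorm_ae _ f)//.
  exact: (@measurable_funPT _ _ T (measurableTypeR R) (repr h)).
pose k : LspaceType mu p1 :=
  HB.pack_for (LspaceType mu p1) h (@isFinLebesgue.Build _ _ _ _ _ p1 h hfin).
by exists k.
Qed.

End Lspace_representatives.

(** * Norms of real-valued functions and their lower semicontinuity *)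

Section Lnorm_real.
Context d (T : measurableType d) (R : realType) (mu : {measure set T -> \bar R}).
Implicit Types (f g : T -> R) (r c : R) (p : \bar R).

Lemma measurable_abs_powR r f : measurable_fun setT f ->
  measurable_fun setT (fun x => (`|f x| `^ r)%:E).
Proof.
move=> mf; apply/measurable_EFinP; apply: (measurableT_comp (measurable_powR _)).
exact: measurableT_comp.
Qed.

Lemma LnormE r f :
  ('N[mu]_r%:E[EFin \o f] = (\int[mu]_x (`|f x| `^ r)%:E) `^ r^-1)%E.
Proof. by rewrite Lnorm.unlock. Qed.

Lemma Lnorm_powR r f : r != 0 ->
  ('N[mu]_r%:E[EFin \o f] `^ r = \int[mu]_x (`|f x| `^ r)%:E)%E.
Proof. by move=> r0; rewrite poweR_Lnorm. Qed.

Lemma integral_powR_ge0 r f : (0 <= \int[mu]_x (`|f x| `^ r)%:E)%E.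
Proof. by apply: integral_ge0 => x _; rewrite lee_fin powR_ge0. Qed.

Lemma Lnorm_leP r c f : 0 < r -> 0 <= c ->
  ('N[mu]_r%:E[EFin \o f] <= c%:E)%E = (\int[mu]_x (`|f x| `^ r)%:E <= (c `^ r)%:E)%E.
Proof.
move=> r0 c0; rewrite -Lnorm_powR ?gt_eqF// -poweR_EFin.
apply/idP/idP => h.
  by apply: (gt0_ler_poweR (ltW r0)) => //; rewrite in_itv/= ?leey ?andbT ?lee_fin ?Lnorm_ge0.
rewrite leNgt; apply/negP => h1.
have := h; apply/negP; rewrite -ltNge.
case: ('N[mu]_ _ [ _ ])%E h1 => [x | |].
- rewrite lte_fin => cx; rewrite poweR_EFin lte_fin; apply: gt0_ltr_powR => //.
  by rewrite nnegrE (le_trans c0 (ltW cx)).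
- by move=> _; rewrite poweRyr ?gt_eqF// poweR_EFin ltry.
- by rewrite ltNge leNye.
Qed.

Lemma Lnormy_leP c f : 0 <= c ->
  ('N[mu]_+oo[EFin \o f] <= c%:E)%E <-> \forall x \ae mu, `|f x| <= c.
Proof.
move=> c0; rewrite Lnorm.unlock.
have [mu0|mu0] := ltP 0%E (mu [set: T]).
  split.
    by move/ess_supP; apply: filterS => x /=.
  by move=> h; apply/ess_supP; apply: filterS h => x /=.
(* On a space of measure zero the L^oo-norm is 0 by convention and every property holds almost
   everywhere. *)
have {}mu0 : mu [set: T] = 0%E by apply/eqP; rewrite eq_le mu0 measure_ge0.
split => _; first exact: measure0_ae.
by rewrite lee_fin.
Qed.

Lemma le_Lnorm p f g : (1 <= p)%E -> measurable_fun setT f -> measurable_fun setT g ->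
  (\forall x \ae mu, `|f x| <= `|g x|) ->
  ('N[mu]_p[EFin \o f] <= 'N[mu]_p[EFin \o g])%E.
Proof.
case: p => // [r|_].
- rewrite lee_fin => r1 mf mg fg.
  have r0 : 0 < r by exact: lt_le_trans r1.
  have ri0 : 0 <= r^-1 by rewrite invr_ge0 ltW.
  rewrite !LnormE; apply: (gt0_ler_poweR ri0).
  + by rewrite in_itv/= leey integral_powR_ge0.
  + by rewrite in_itv/= leey integral_powR_ge0.
  apply: ae_ge0_le_integral => //.
  + exact: measurable_abs_powR.
  + exact: measurable_abs_powR.
  + apply: filterS fg => x h _; rewrite lee_fin; by apply: (ge0_ler_powR (ltW r0)); rewrite ?nnegrE.
- move=> mf mg fg; rewrite Lnorm.unlock; case: ifP => // _.
  apply: le_ess_sup; apply: filterS fg => x h /=; by rewrite lee_fin.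
Qed.

Lemma Lnorm_eq0_ae p f : (1 <= p)%E -> measurable_fun setT f ->
  ('N[mu]_p[EFin \o f] = 0)%E -> f = cst 0 %[ae mu].
Proof.
move=> p1 mf /Lnorm_eq0_eq0 h.
have /h : measurable_fun setT (EFin \o f) by exact/measurable_EFinP.
move=> /(_ (lt_le_trans lte01 p1)); apply: filterS => x /= /[apply] -[].
by [].
Qed.

Lemma continuous_abs_powR r : 0 < r -> continuous (fun x : R => `|x| `^ r).
Proof.
move=> r0 x; have [->|x0] := eqVneq x 0.
  apply/cvgrPdist_lt => e e0.
  rewrite normr0 powR0 ?gt_eqF//.
  have a0 : 0 < e `^ r^-1 by rewrite powR_gt0.
  have /= := @nbhs0_lt _ R^o _ a0.
  apply: filterS => y yr; rewrite sub0r normrN norm_powR// normr_id.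
  have -> : e = (e `^ r^-1) `^ r by rewrite -powRrM mulVf ?gt_eqF// powRr1// ltW.
  by apply: gt0_ltr_powR; rewrite ?nnegrE ?powR_ge0.
have h : differentiable (fun y : R => y `^ r) `|x|.
  by apply/derivable1_diffP; apply: derivable_powR; rewrite in_itv/= andbT normr_gt0.
exact: (cvg_comp _ _ (@norm_continuous _ R^o x) (differentiable_continuous h)).
Qed.

Lemma cvg_nneseries_terms (u : R ^nat) : (forall n, 0 <= u n) ->
  (\sum_(0 <= k <oo) (u k)%:E < +oo)%E -> u @ \oo --> 0.
Proof.
move=> u0 su.
have h : (u k)%:E @[k --> \oo] --> 0%E.
  have := nneseries_tail_cvg su (fun k _ => u0 k).
  apply: (@squeeze_cvge _ _ _ _ (cst 0%E)) => //; last exact: cvg_cst.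
  apply: nearW => n /=; rewrite lee_fin u0 /=.
  have := @nneseries_lim_ge R (fun k => (u k)%:E) predT n n.+1 (fun k _ _ => u0 k).
  by rewrite big_nat1.
by move/fine_cvgP : h => [_].
Qed.

(** The series of the |g_k|^r has integral at most 1, hence is finite almost everywhere, and its
    terms tend to 0. *)
Lemma ae_cvg0_summable r (g : nat -> T -> R) : 0 < r ->
  (forall k, measurable_fun setT (g k)) ->
  (forall k, (\int[mu]_x (`|g k x| `^ r)%:E <= (1 / (2 ^ k.+1)%:R)%:E)%E) ->
  \forall x \ae mu, g k x @[k --> \oo] --> 0.
Proof.
move=> r0 mg ig.
have mF k : measurable_fun setT (fun x => (`|g k x| `^ r)%:E) by exact: measurable_abs_powR.
have F0 k x : (0 <= (`|g k x| `^ r)%:E)%E by rewrite lee_fin powR_ge0.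
pose S x := (\sum_(0 <= k <oo) (`|g k x| `^ r)%:E)%E.
have S0 x : (0 <= S x)%E by apply: nneseries_ge0 => k _ _; exact: F0.
have mS : measurable_fun setT S by apply: ge0_emeasurable_sum => // k x _ _; exact: F0.
have iS : (\int[mu]_x S x <= 1%:E)%E.
  rewrite /S integral_nneseries//.
  apply: (le_trans _ (epsilon_trick0 xpredT (@ler01 R))).
  by apply: lee_nneseries => [k _ _|k _]; [exact: integral_powR_ge0|exact: ig].
have intS : mu.-integrable setT S.
  apply/integrableP; split => //.
  under eq_integral do rewrite gee0_abs//.
  by rewrite (le_lt_trans iS)// ltry.
have := integrable_ae measurableT intS.
apply: filterS => x /(_ I) Sx.
have /cvg_nneseries_terms h : forall k, 0 <= `|g k x| `^ r by move=> k; exact: powR_ge0.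
have {}h : `|g k x| `^ r @[k --> \oo] --> 0 by apply: h; rewrite -ge0_fin_numE; [exact: Sx|exact: S0].
apply/cvgrPdist_lt => e e0; move/cvgrPdist_lt : h => /(_ _ (powR_gt0 r e0)).
apply: filterS => k; rewrite !sub0r !normrN norm_powR// normr_id => h.
rewrite ltNge; apply/negP => ek; move: h; rewrite ltNge => /negP; apply.
by apply: (ge0_ler_powR (ltW r0)) => //; rewrite nnegrE // ltW.
Qed.

(** Fatou's lemma for a finite exponent; for L^oo, the pointwise bounds pass to the limit outside a
    countable union of null sets. *)
Lemma Lnorm_le_ae_cvg (p : \bar R) (f_ : nat -> T -> R) (f : T -> R) (c : R) :
  (1 <= p)%E -> (forall n, measurable_fun setT (f_ n)) -> measurable_fun setT f ->
  (\forall x \ae mu, f_ n x @[n --> \oo] --> f x) -> 0 <= c ->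
  (forall n, 'N[mu]_p[EFin \o f_ n] <= c%:E)%E -> ('N[mu]_p[EFin \o f] <= c%:E)%E.
Proof.
case: p => // [r|_].
- rewrite lee_fin => r1 mf_ mf ff c0 h.
  have r0 : 0 < r by exact: lt_le_trans r1.
  rewrite Lnorm_leP//.
  have -> : (\int[mu]_x (`|f x| `^ r)%:E = \int[mu]_x limn_einf (fun n => (`|f_ n x| `^ r)%:E))%E.
    apply: ae_eq_integral => //.
    + exact: measurable_abs_powR.
    + under eq_fun do rewrite -[limn_einf _]oppeK -limn_esupN.
      apply: measurableT_comp => //; apply: measurable_fun_limn_esup => n.
      by apply: measurableT_comp => //; exact: measurable_abs_powR.
    + apply: filterS ff => x fx _; apply/esym.
      apply: (cvg_limn_einf_sup _).1; apply: cvg_EFin; first exact: nearW.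
      rewrite (_ : fine \o _ = fun n => `|f_ n x| `^ r)//.
      apply: (@continuous_cvg _ _ _ _ _ (fun n => f_ n x) (fun y : R => `|y| `^ r) (f x)) => //.
      exact: continuous_abs_powR.
  have mF n : measurable_fun setT (fun x => (`|f_ n x| `^ r)%:E) by exact: measurable_abs_powR.
  have F0 n x : setT x -> (0 <= (`|f_ n x| `^ r)%:E)%E by rewrite lee_fin powR_ge0.
  apply: (le_trans (fatou mu measurableT mF F0)).
  rewrite limn_einf_lim; apply: lime_le; first exact: is_cvg_einfs.
  apply: nearW => n; apply: (@le_trans _ _ (\int[mu]_x (`|f_ n x| `^ r)%:E)%E).
    by apply: ereal_inf_lbound; exists n => /=.
  by rewrite -Lnorm_leP.
- move=> mf_ mf ff c0 h; apply/Lnormy_leP => //.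
  have {}h : \forall x \ae mu, forall n, `|f_ n x| <= c.
    by apply: ae_foralln => n; exact/Lnormy_leP.
  near=> x.
  have fx : f_ n x @[n --> \oo] --> f x by near: x.
  have hx : forall n, `|f_ n x| <= c by near: x.
  apply: (@cvgr_to_le _ \oo _ _ (fun n => `|f_ n x|)); last by apply: nearW => n; exact: hx.
  exact: (cvg_norm fx).
Unshelve. all: by end_near.
Qed.

(* Convergence in [L^r] gives an a.e. convergent subsequence. *)
Lemma Lnorm_lsc r (p : \bar R) (f_ : nat -> T -> R) (f : T -> R) (c : R) : 1 <= r ->
  (1 <= p)%E -> (forall n, measurable_fun setT (f_ n)) -> measurable_fun setT f ->
  'N[mu]_r%:E[EFin \o (f_ n \- f)%R]%E @[n --> \oo] --> 0%E -> 0 <= c ->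
  (forall e : R, 0 < e -> \forall n \near \oo, ('N[mu]_p[EFin \o f_ n] <= (c + e)%:E)%E) ->
  ('N[mu]_p[EFin \o f] <= c%:E)%E.
Proof.
move=> r1 p1 mf_ mf cf c0 h.
apply/lee_addgt0Pr => e e0; rewrite -EFinD.
have r0 : 0 < r by exact: lt_le_trans r1.
have H k : exists n, (\int[mu]_x (`|(f_ n \- f) x| `^ r)%:E <= (1 / (2 ^ k.+1)%:R)%:E)%E /\
   ('N[mu]_p[EFin \o f_ n] <= (c + e)%:E)%E.
  (* The threshold [a] makes the r-th power of the norm at most 2^-(k+1), the rate that
     [ae_cvg0_summable] asks for. *)
  pose a := (1 / (2 ^ k.+1)%:R : R) `^ r^-1.
  have a0 : 0 < a by rewrite powR_gt0// divr_gt0// ltr0n expn_gt0.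
  have : \forall n \near \oo, ('N[mu]_r%:E[EFin \o (f_ n \- f)%R] <= a%:E)%E.
    have /fine_cvgP [fin /cvgr_le /(_ _ a0)] := cf.
    apply: filterS2 fin => n /fineK <-; by rewrite lee_fin.
  move=> h1.
  have [n [n1 n2]] : exists n, ('N[mu]_r%:E[EFin \o (f_ n \- f)%R] <= a%:E)%E /\ ('N[mu]_p[EFin \o f_ n] <= (c + e)%:E)%E.
    have [N _ /(_ N (leqnn _))] := filterI h1 (h _ e0); by move=> [? ?]; exists N.
  exists n; split => //.
  have ar : a `^ r = 1 / (2 ^ k.+1)%:R by rewrite /a -powRrM mulVf ?gt_eqF// powRr1.
  by move: n1; rewrite (Lnorm_leP _ r0 (ltW a0)) ar.
pose n_ k := sval (cid (H k)).
have hn k := svalP (cid (H k)).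
apply: (@Lnorm_le_ae_cvg p (fun k => f_ (n_ k))) => //.
- have := @ae_cvg0_summable r (fun k => f_ (n_ k) \- f) r0.
  move=> /(_ (fun k => measurable_funB (mf_ _) mf) (fun k => (hn k).1)).
  by apply: filterS => x; move/subr_cvg0.
- by rewrite addr_ge0// ltW.
- by move=> k; exact: (hn k).2.
Qed.

End Lnorm_real.

(** * Convexity of powers and the test functions in [J0] *)

Section powR_convexity.
Context {R : realType}.
Implicit Types a b q x y : R.

Lemma powRE a x : 0 < a -> a `^ x = expR (x * ln a).
Proof. by move=> a0; rewrite /powR gt_eqF. Qed.

(* Young's inequality applied to [b] and [a `^ (q - 1)]. *)
Lemma powR_tangent q a b : 1 <= q -> 0 <= a -> 0 <= b ->
  a `^ q + q * a `^ (q - 1) * (b - a) <= b `^ q.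
Proof.
rewrite le_eqVlt => /predU1P[<-|q1] a0 b0.
  (* For q = 1 the slope is a^0, which is 1 even at a = 0. *)
  rewrite subrr powRr0 !powRr1//; lra.
have q0 : 0 < q by lra.
have q10 : 0 < q - 1 by lra.
have h := @conjugate_powR R b (a `^ (q - 1)) q (q / (q - 1)) b0 (powR_ge0 _ _) q0.
have {}h : b * a `^ (q - 1) <= b `^ q / q + a `^ q * ((q - 1) / q).
  have -> : a `^ q * ((q - 1) / q) = a `^ (q - 1) `^ (q / (q - 1)) / (q / (q - 1)).
    rewrite -powRrM (_ : (q - 1) * (q / (q - 1)) = q) ?invf_div//.
    by field; rewrite gt_eqF.
  apply: h; first by rewrite divr_gt0.
  by field; rewrite !gt_eqF.
have aq : a * a `^ (q - 1) = a `^ q by rewrite mulr_powRB1.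
have : q * (b * a `^ (q - 1)) <= q * (b `^ q / q + a `^ q * ((q - 1) / q)).
  by rewrite ler_pM2l.
have -> : q * (b `^ q / q + a `^ q * ((q - 1) / q)) = b `^ q + (q - 1) * a `^ q.
  by field; rewrite gt_eqF.
have := congr1 (fun z => q * z) aq; rewrite /=; lra.
Qed.

(** The tangent inequality at m = a |x| + (1 - a) |y| is averaged over |x| and |y|; the linear terms
    cancel. *)
Lemma convex_abs_powR q x y a : 1 <= q -> 0 <= a <= 1 ->
  `|a * x + (1 - a) * y| `^ q <= a * `|x| `^ q + (1 - a) * `|y| `^ q.
Proof.
move=> q1 /andP[a0 a1].
have a1' : 0 <= 1 - a by lra.
set m := a * `|x| + (1 - a) * `|y|.
have m0 : 0 <= m by rewrite addr_ge0// mulr_ge0.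
have q0 : 0 <= q by lra.
apply: (@le_trans _ _ (m `^ q)).
  apply: ge0_ler_powR; rewrite ?nnegrE//.
  by rewrite (le_trans (ler_normD _ _))// !normrM (ger0_norm a0) (ger0_norm a1').
have hx := powR_tangent q1 m0 (normr_ge0 x).
have hy := powR_tangent q1 m0 (normr_ge0 y).
have := lerD (ler_wpM2l a0 hx) (ler_wpM2l a1' hy).
apply: le_trans; rewrite [leRHS](_ : _ = m `^ q + q * m `^ (q - 1) * (a * `|x| + (1 - a) * `|y| - m)); last ring.
by rewrite -/m subrr mulr0 addr0.
Qed.

Lemma convex_posB_abs c x y a : 0 <= a <= 1 ->
  Num.max (`|a * x + (1 - a) * y| - c) 0 <=
  a * Num.max (`|x| - c) 0 + (1 - a) * Num.max (`|y| - c) 0.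
Proof.
move=> /andP[a0 a1].
have a1' : 0 <= 1 - a by lra.
have mx0 (z : R) : 0 <= Num.max z 0 by rewrite le_max lexx orbT.
have mxz (z : R) : z <= Num.max z 0 by rewrite le_max lexx.
rewrite ge_max; apply/andP; split; last by rewrite addr_ge0// mulr_ge0.
have h : `|a * x + (1 - a) * y| <= a * `|x| + (1 - a) * `|y|.
  by rewrite (le_trans (ler_normD _ _))// !normrM (ger0_norm a0) (ger0_norm a1').
have := ler_wpM2l a0 (mxz (`|x| - c)).
have := ler_wpM2l a1' (mxz (`|y| - c)).
by lra.
Qed.

Lemma J0_EFin (j : R -> R) : continuous j -> (forall x, 0 <= j x) -> j 0 = 0 ->
  (forall x y a, 0 <= a <= 1 -> j (a * x + (1 - a) * y) <= a * j x + (1 - a) * j y) ->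
  J0 (fun x => (j x)%:E).
Proof.
move=> cj j0 jz jc; split.
- by move=> x y a a01; rewrite -!EFinM -EFinD lee_fin jc.
- move=> x a; rewrite lte_fin => ax.
  exists [set y | a < j y] => //.
  exact: (@cvgr_gt _ _ (nbhs x) _ j (j x) (cj x) a ax).
- by move=> x; rewrite lee_fin.
- by rewrite jz.
Qed.

Lemma J0_abs_powR q : 1 <= q -> J0 (fun x : R => (`|x| `^ q)%:E).
Proof.
move=> q1; have q0 : 0 < q by lra.
apply: J0_EFin => [|x||x y a].
- exact: continuous_abs_powR.
- exact: powR_ge0.
- by rewrite normr0 powR0 ?gt_eqF.
- exact: convex_abs_powR.
Qed.

(** The integral of (|f| - c)^+ vanishes exactly when |f| <= c almost everywhere, which is how
    complete accretivity is tested on the L^oo-norm. *)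
Lemma J0_posB_abs c : 0 <= c -> J0 (fun x : R => (Num.max (`|x| - c) 0)%:E).
Proof.
move=> c0; apply: J0_EFin => [x|x||x y a].
- rewrite (_ : (fun _ => _) = (fun y : R => (`|y| - c + `| `|y| - c |) / 2)); last first.
    by apply/funext => y; rewrite maxr_absE subr0 addr0.
  have h : continuous (fun y : R => `|y| - c).
    by move=> y; apply: cvgB; [exact: (@norm_continuous _ R^o)|exact: cvg_cst].
  apply: cvgM; last exact: cvg_cst.
  by apply: cvgD; [exact: h|apply: cvg_norm; exact: h].
- by rewrite le_max lexx orbT.
- by rewrite normr0 sub0r; apply/max_idPr; rewrite oppr_le0.
- exact: convex_posB_abs.
Qed.

End powR_convexity.

Section contraction.
Context d (T : measurableType d) (R : realType) (mu : {measure set T -> \bar R}).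

Lemma Lnorm_scale (p : \bar R) (f : T -> R) (c : R) : (1 <= p)%E -> 0 <= c ->
  measurable_fun setT f ->
  ('N[mu]_p[EFin \o (fun x => (c * f x)%R)] = c%:E * 'N[mu]_p[EFin \o f])%E.
Proof.
move=> + c0 mf; case: p => // [r|_].
  rewrite lee_fin => r1; have r0 : 0 < r by exact: lt_le_trans r1.
  rewrite !LnormE.
  under eq_integral do rewrite normrM (ger0_norm c0) powRM// EFinM.
  rewrite ge0_integralZl_EFin ?powR_ge0//; last exact: measurable_abs_powR.
  rewrite poweRM ?lee_fin ?powR_ge0 ?integral_powR_ge0//.
  by rewrite poweR_EFin -powRrM mulfV ?gt_eqF// powRr1.
rewrite Lnorm.unlock; case: ifP => m0; last by rewrite mule0.
rewrite -ess_supZl//; apply/eq_ess_sup/nearW => x /=.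
by rewrite normrM ger0_norm.
Qed.

(** The test function is |.|^r for finite exponents. For L^oo it is (|x| - c)^+ with c the norm of
    [g]: its integral along [g] is 0, hence also along [f]. *)
Lemma Lnorm_contraction (f g : T -> R) : measurable_fun setT f -> measurable_fun setT g ->
  (forall j : R -> \bar R, J0 j -> (\int[mu]_x j (f x) <= \int[mu]_x j (g x))%E) ->
  forall p, (1 <= p)%E -> ('N[mu]_p[EFin \o f] <= 'N[mu]_p[EFin \o g])%E.
Proof.
move=> mf mg fg [r|_|//].
  rewrite lee_fin => r1; have r0 : 0 < r by exact: lt_le_trans r1.
  have ri0 : 0 <= r^-1 by rewrite invr_ge0 ltW.
  rewrite !LnormE; apply: (gt0_ler_poweR ri0).
  - by rewrite in_itv/= leey integral_powR_ge0.
  - by rewrite in_itv/= leey integral_powR_ge0.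
  exact: (fg _ (J0_abs_powR r1)).
have : (0 <= 'N[mu]_+oo[EFin \o g])%E by exact: Lnorm_ge0.
case Eg : ('N[mu]_+oo[EFin \o g])%E => [c| |] // c0; last by rewrite leey.
rewrite lee_fin in c0.
have gc : \forall x \ae mu, `|g x| <= c by apply/Lnormy_leP => //; rewrite Eg.
apply/Lnormy_leP => //.
have := fg _ (J0_posB_abs c0).
have mj (h : T -> R) : measurable_fun setT h ->
    measurable_fun setT (fun x => (Num.max (`|h x| - c) 0)%:E).
  move=> mh; apply/measurable_EFinP; apply: measurable_maxr => //.
  by apply: measurable_funB => //; exact: measurableT_comp.
have -> : (\int[mu]_x (Num.max (`|g x| - c) 0)%:E = \int[mu]_x (cst 0 x))%E.
  apply: ae_eq_integral => //; first exact: mj.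
  by apply: filterS gc => x gx _ /=; congr EFin; apply/max_idPr; rewrite subr_le0.
rewrite integral0 => h.
have h0 x : (0 <= (Num.max (`|f x| - c) 0)%:E)%E by rewrite lee_fin le_max lexx orbT.
have {}h : (\int[mu]_x `|(Num.max (`|f x| - c) 0)%:E| = 0)%E.
  under eq_integral do rewrite gee0_abs//.
  by apply/eqP; rewrite eq_le h integral_ge0.
have := (ae_eq_integral_abs mu measurableT (mj _ mf)).1 h.
apply: filterS => x /(_ I) [] /max_idPr; by rewrite subr_le0.
Qed.

End contraction.

Section Lspace_arithmetic.
Context d (T : measurableType d) (R : realType) (mu : {measure set T -> \bar R}).
Context (p : \bar R) (p1 : (1 <= p)%E).
Implicit Types u v : LspaceType mu p1.

Lemma Lspace_finite u : ('N[mu]_p[EFin \o (u : T -> R)] < +oo)%E.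
Proof. exact: Lebesgue_finite. Qed.

Lemma finite_norm_scale (f : T -> R) (c : R) : measurable_fun setT f ->
  finite_norm mu p f -> finite_norm mu p (fun x => c * f x).
Proof.
move=> mf ff; rewrite /finite_norm.
apply: (@le_lt_trans _ _ ('N[mu]_p[EFin \o (fun x => (`|c| * f x)%R)])%E).
  apply: le_Lnorm => //; [exact: measurable_funM|exact: measurable_funM|].
  by apply: nearW => x; rewrite !normrM normr_id.
by rewrite Lnorm_scale// lte_mul_pinfty// ?lee_fin.
Qed.

Lemma finite_normD (f g : T -> R) : measurable_fun setT f -> measurable_fun setT g ->
  finite_norm mu p f -> finite_norm mu p g -> finite_norm mu p (f \+ g).
Proof.
move=> mf mg ff fg; apply: (le_lt_trans (eminkowski _ _ _ _)) => //.
exact: lte_add_pinfty.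
Qed.

Lemma finite_normB (f g : T -> R) : measurable_fun setT f -> measurable_fun setT g ->
  finite_norm mu p f -> finite_norm mu p g -> finite_norm mu p (f \- g).
Proof.
move=> mf mg ff fg.
rewrite (_ : f \- g = f \+ (fun x => -1 * g x)); last by apply/funext => x /=; rewrite mulN1r.
apply: finite_normD => //; first exact: measurable_funM.
exact: finite_norm_scale.
Qed.

Lemma Lspace_lin u v (c : R) : exists w : LspaceType mu p1,
  (w : T -> R) = (fun x => u x + c * v x) %[ae mu].
Proof.
apply: Lspace_surj.
  by apply: measurable_funD; [|apply: measurable_funM => //]; exact: Lspace_measurable.
apply: finite_normD; [exact: Lspace_measurable| | |].
- by apply: measurable_funM => //; exact: Lspace_measurable.
- exact: Lspace_finite.
- by apply: finite_norm_scale; [exact: Lspace_measurable|exact: Lspace_finite].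
Qed.

Lemma Lspace_scale u (c : R) : exists w : LspaceType mu p1,
  (w : T -> R) = (fun x => c * u x) %[ae mu].
Proof.
apply: Lspace_surj.
  by apply: measurable_funM => //; exact: Lspace_measurable.
by apply: finite_norm_scale; [exact: Lspace_measurable|exact: Lspace_finite].
Qed.

Lemma measurable_LspaceB u v : measurable_fun setT ((u : T -> R) \- (v : T -> R)).
Proof. by apply: measurable_funB; exact: Lspace_measurable. Qed.

Lemma Ldist_finite u v : (Ldist mu p u v < +oo)%E.
Proof.
apply: finite_normB; by [exact: Lspace_measurable|exact: Lspace_finite].
Qed.

Lemma Ldist_fineK u v : (fine (Ldist mu p u v))%:E = Ldist mu p u v.
Proof.
by rewrite fineK// ge0_fin_numE ?Ldist_finite//; exact: Lnorm_ge0.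
Qed.

End Lspace_arithmetic.

(** * Resolvents and the implicit Euler scheme *)

Section resolvent_accretive.
Context d (T : measurableType d) (R : realType) (mu : {measure set T -> \bar R}).
Context (p : \bar R) (p1 : (1 <= p)%E) (A : Lop mu p1) (omega : R).
Hypothesis hA : completely_accretive (Lshift A omega).
Implicit Types (f g u v : LspaceType mu p1) (h : R).

(* [f = u + h v] with [v \in A u] is the same as
   [f / (1 - omega h) = u + (h / (1 - omega h)) (v + omega u)]. *)
Lemma resolvent_shift h f u : omega * h < 1 -> resolvent A h f u ->
  exists2 g : LspaceType mu p1, (g : T -> R) = (fun x => (1 - omega * h)^-1 * f x) %[ae mu] &
    resolvent (Lshift A omega) (h / (1 - omega * h)) g u.
Proof.
move=> oh1 [v Auv fuv].
have [z hz] := Lspace_lin v u omega.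
have [g hg] := Lspace_scale f (1 - omega * h)^-1.
exists g => //; exists z.
  by exists v.
near=> x => _.
have -> : g x = (1 - omega * h)^-1 * f x by near: x; apply: filterS hg => x; exact.
have -> : f x = u x + h * v x by near: x; apply: filterS fuv => x; exact.
have -> : z x = v x + omega * u x by near: x; apply: filterS hz => x; exact.
by field; rewrite gt_eqF// subr_gt0.
Unshelve. all: by end_near.
Qed.

Lemma resolvent_inj h f u u' : 0 < h -> omega * h < 1 ->
  resolvent A h f u -> resolvent A h f u' -> u = u'.
Proof.
move=> h0 oh1 ru ru'.
have [g hg rg] := resolvent_shift oh1 ru.
have [g' hg' rg'] := resolvent_shift oh1 ru'.
have gg' : g = g'.
  apply: Lspace_ae_inj; apply: filterS2 hg hg' => x hx hx' _; by rewrite hx// hx'.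
rewrite -gg' in rg'.
have l0 : 0 < h / (1 - omega * h) by rewrite divr_gt0// subr_gt0.
exact: ((hA l0).1 _ _ _ rg rg').
Qed.

(** The solutions are resolvents of [Lshift A omega] at the data divided by 1 - omega h, so the
    contraction for that completely accretive operator acquires this factor. *)
Lemma resolvent_contraction h f f' u u' (s : \bar R) : 0 < h -> omega * h < 1 ->
  resolvent A h f u -> resolvent A h f' u' -> (1 <= s)%E ->
  (Ldist mu s u u' <= (1 - omega * h)^-1%:E * Ldist mu s f f')%E.
Proof.
move=> h0 oh1 ru ru' s1.
have [g hg rg] := resolvent_shift oh1 ru.
have [g' hg' rg'] := resolvent_shift oh1 ru'.
have l0 : 0 < h / (1 - omega * h) by rewrite divr_gt0// subr_gt0.
have b0 : 0 <= (1 - omega * h)^-1 by rewrite invr_ge0 subr_ge0 ltW.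
have mB := @measurable_LspaceB _ _ _ mu p p1.
have := @Lnorm_contraction _ _ _ mu _ _ (mB u u') (mB g g') ((hA l0).2 _ _ _ _ rg rg') s s1.
rewrite /Ldist -Lnorm_scale//.
rewrite (@Lnorm_ae _ _ _ mu s s1 (g \- g') (fun x => (1 - omega * h)^-1 * (f \- f') x))//.
- by apply: measurable_funM.
- apply: filterS2 hg hg' => x hx hx' _ /=; by rewrite hx// hx'// -mulrBr.
Qed.

Lemma resolvent_iter_inj h n f u u' : 0 < h -> omega * h < 1 ->
  resolvent_iter A h n f u -> resolvent_iter A h n f u' -> u = u'.
Proof.
move=> h0 oh1; elim: n u u' => [u u' /= -> -> //|n IH u u' /= [g ig rg] [g' ig' rg']].
by have gg' := IH _ _ ig ig'; subst g'; exact: resolvent_inj rg rg'.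
Qed.

Lemma resolvent_iter_add h m n f u :
  resolvent_iter A h (n + m) f u ->
  exists2 g, resolvent_iter A h m f g & resolvent_iter A h n g u.
Proof.
elim: n u => [u iu|n IH u /= [w /IH[g ig iw] rw]]; first by exists u.
by exists g => //; exists w.
Qed.

Lemma resolvent_iter_contraction h n f f' u u' (s : \bar R) : 0 < h -> omega * h < 1 ->
  resolvent_iter A h n f u -> resolvent_iter A h n f' u' -> (1 <= s)%E ->
  (Ldist mu s u u' <= ((1 - omega * h)^-1 ^+ n)%:E * Ldist mu s f f')%E.
Proof.
move=> h0 oh1 + + s1; elim: n u u' => [u u' /= -> ->|n IH u u' /= [g ig rg] [g' ig' rg']].
  by rewrite expr0 mul1e.
apply: (le_trans (resolvent_contraction h0 oh1 rg rg' s1)).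
rewrite exprS EFinM -muleA; apply: lee_wpmul2l; last exact: IH.
by rewrite lee_fin invr_ge0 subr_ge0 ltW.
Qed.

End resolvent_accretive.

(** * The q-bracket as a one-sided derivative *)

Section bracket.
Context d (T : measurableType d) (R : realType) (mu : {measure set T -> \bar R}).
Context (q : R) (q1 : 1 <= q).

(** q times this is the right derivative at h = 0 of |a + h b|^q; for q = 1 the value |b| at a = 0
    joins the two integrals of [qbracket] into one. *)
Definition bracket_integrand (a b : R) : R :=
  if q == 1 then (if a == 0 then `|b| else Num.sg a * b)
  else `|a| `^ (q - 2) * a * b.

Lemma abs_mul_bracket (a b : R) : q != 1 ->
  `|bracket_integrand a b| = `|a| `^ (q - 1) * `|b|.
Proof.
move=> q1'; rewrite /bracket_integrand (negbTE q1') !normrM norm_powR// normr_id.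
have q10 : 0 < q - 1 by rewrite subr_gt0 lt_neqAle eq_sym q1'.
have [->|a0] := eqVneq a 0; first by rewrite normr0 mulr0 mul0r [in RHS]powR0 ?mul0r ?gt_eqF.
congr (_ * _); rewrite mulrC -[X in X * _]powRr1// -powRD.
  by congr (_ `^ _); ring.
by rewrite normr_eq0 a0 implybT.
Qed.

(** The larger of |a| and |b| dominates both factors. This makes the bracket of two L^q-functions
    integrable. *)
Lemma bracket_integrand_bound (a b : R) :
  `|bracket_integrand a b| <= `|a| `^ q + `|b| `^ q.
Proof.
have [q1'|q1'] := eqVneq q 1.
  rewrite /bracket_integrand q1' eqxx !powRr1//.
  case: eqVneq => [->|a0]; first by rewrite normr0 add0r normr_id.
  by rewrite normrM normr_sg a0 mul1r lerDr.
rewrite abs_mul_bracket//.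
have q0 : 0 <= q by exact: (le_trans ler01 q1).
have q10 : 0 <= q - 1 by rewrite subr_ge0.
have hm (x : R) : 0 <= x -> x `^ (q - 1) * x = x `^ q.
  by move=> x0; rewrite mulrC mulr_powRB1 ?(lt_le_trans ltr01).
have [ab|/ltW ba] := leP `|a| `|b|.
  apply: (@le_trans _ _ (`|b| `^ q)); last by rewrite lerDr powR_ge0.
  rewrite -[leRHS]hm//; apply: ler_wpM2r => //.
  exact: (ge0_ler_powR q10).
apply: (@le_trans _ _ (`|a| `^ q)); last by rewrite lerDl powR_ge0.
by rewrite -[leRHS]hm//; apply: ler_wpM2l => //; exact: powR_ge0.
Qed.

(** A convex function lies above its tangent. For q = 1 and a nonzero, a + h b is multiplied by the
    sign of a; for q > 1, [powR_tangent] at |a| is combined with |a + h b| - |a| >= sg(a) h b. *)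
Lemma bracket_integrand_tangent (a b h : R) : 0 < h ->
  `|a| `^ q + q * h * bracket_integrand a b <= `|a + h * b| `^ q.
Proof.
move=> h0; have [q1'|q1'] := eqVneq q 1.
  rewrite /bracket_integrand q1' eqxx !powRr1// mul1r.
  case: eqVneq => [->|a0]; first by rewrite normr0 !add0r normrM (gtr0_norm h0).
  have -> : `|a| + h * (Num.sg a * b) = Num.sg a * (a + h * b).
    by rewrite mulrDr -normrEsg; ring.
  by rewrite (le_trans (ler_norm _))// normrM normr_sg a0 mul1r.
have q10 : 0 < q - 1 by rewrite subr_gt0 lt_neqAle eq_sym q1'.
apply: le_trans (powR_tangent q1 (normr_ge0 a) (normr_ge0 _)).
rewrite lerD2l -!mulrA ler_wpM2l//; first by exact: (le_trans ler01 q1).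
rewrite /bracket_integrand (negbTE q1').
have [->|a0] := eqVneq a 0; first by rewrite !(mulr0,mul0r) normr0 (@powR0 _ (q - 1)) ?mul0r ?gt_eqF.
have -> : h * (`|a| `^ (q - 2) * a * b) = `|a| `^ (q - 1) * (Num.sg a * (h * b)).
  have -> : `|a| `^ (q - 1) = `|a| `^ (q - 2) * `|a|.
    rewrite -[X in _ * X]powRr1// -powRD; first by congr (_ `^ _); ring.
    by rewrite normr_eq0 a0 implybT.
  rewrite [RHS](_ : _ = h * (`|a| `^ (q - 2) * (Num.sg a * `|a|) * b)); last by ring.
  by rewrite -numEsg.
apply: ler_wpM2l; first exact: powR_ge0.
rewrite lerBrDl.
have -> : `|a| + Num.sg a * (h * b) = Num.sg a * (a + h * b) by rewrite mulrDr -normrEsg.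
by rewrite (le_trans (ler_norm _))// normrM normr_sg a0 mul1r.
Qed.

Lemma measurable_bracket (w z : T -> R) : measurable_fun setT w -> measurable_fun setT z ->
  measurable_fun setT (fun x => bracket_integrand (w x) (z x)).
Proof.
move=> mw mz; rewrite /bracket_integrand; case: (q == 1).
  have m0 c : measurable_fun setT (fun=> c : R) by exact: measurable_cst.
  have mw0 : measurable_fun setT (fun x => w x == 0) by exact: measurable_fun_eqr.
  apply: measurable_fun_ifT => //; first exact: measurableT_comp.
  apply: measurable_funM => //.
  under eq_fun do rewrite /Num.sg.
  apply: measurable_fun_ifT => //; apply: measurable_fun_ifT => //.
  exact: measurable_fun_ltr.
apply: measurable_funM => //; apply: measurable_funM => //.
by apply: (measurableT_comp (measurable_powR _)); exact: measurableT_comp.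
Qed.

Lemma qbracketE (w z : T -> R) : measurable_fun setT w -> measurable_fun setT z ->
  mu.-integrable setT (fun x => (bracket_integrand (w x) (z x))%:E) ->
  qbracket mu q w z = \int[mu]_x bracket_integrand (w x) (z x).
Proof.
move=> mw mz ib; rewrite /qbracket.
have [qe|qe] := eqVneq q 1; last first.
  by apply: eq_Rintegral => x _; rewrite /bracket_integrand (negbTE qe).
have m0 c : measurable_fun setT (fun=> c : R) by exact: measurable_cst.
have mw0 : measurable_fun setT (fun x => w x == 0) by exact: measurable_fun_eqr.
have mA : measurable [set x | w x = 0].
  by have := mw measurableT [set 0] (measurable_set1 _); rewrite setTI.
have eA : [set x | w x != 0] = ~` [set x | w x = 0].
  by apply/seteqP; split => x /= /eqP.
have mAC : measurable [set x | w x != 0] by rewrite eA; exact: measurableC.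
have UA : [set x | w x != 0] `|` [set x | w x = 0] = setT.
  by rewrite eA setUC setUv.
rewrite -[RHS](_ : \int[mu]_(x in [set x | w x != 0] `|` [set x | w x = 0])
   bracket_integrand (w x) (z x) = _); last by rewrite UA.
rewrite Rintegral_setU//; last 2 first.
- by rewrite UA.
- by apply/disj_setPS => x [/= /eqP].
congr (_ + _); apply: eq_Rintegral => x /set_mem /= wx; rewrite /bracket_integrand qe eqxx.
  by rewrite (negbTE wx).
by rewrite wx eqxx.
Qed.

Lemma integrable_powR (w : T -> R) : measurable_fun setT w -> finite_norm mu q%:E w ->
  mu.-integrable setT (fun x => (`|w x| `^ q)%:E).
Proof.
move=> mw fw; apply: Lfun_integrable => //.
by rewrite inE; apply/andP; split; rewrite inE.
Qed.

Lemma fine_Lnorm_powR (w : T -> R) :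
  fine ('N[mu]_q%:E[EFin \o w])%E `^ q = \int[mu]_x (`|w x| `^ q).
Proof.
by rewrite -fine_poweR Lnorm_powR// gt_eqF// (lt_le_trans ltr01).
Qed.

(** With w, z, g' the differences of two solutions, of chosen values of A there and of the data,
    this measures the loss of L^q-norm in one implicit Euler step. *)
Lemma qbracket_tangent (w z g' : T -> R) (h : R) :
  measurable_fun setT w -> measurable_fun setT z -> measurable_fun setT g' ->
  finite_norm mu q%:E w -> finite_norm mu q%:E z -> finite_norm mu q%:E g' ->
  0 < h -> g' = (fun x => w x + h * z x) %[ae mu] ->
  fine ('N[mu]_q%:E[EFin \o w])%E `^ q + q * h * qbracket mu q w z
    <= fine ('N[mu]_q%:E[EFin \o g'])%E `^ q.
Proof.
move=> mw mz mg' fw fz + h0 ge; rewrite /finite_norm.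
set g := fun x => w x + h * z x in ge *.
have mg : measurable_fun setT g by apply: measurable_funD => //; exact: measurable_funM.
rewrite (Lnorm_ae (q1 : (1 <= q%:E)%E) mg' mg ge) => fg.
have iw := integrable_powR mw fw.
have iz := integrable_powR mz fz.
have ig := integrable_powR mg fg.
have mb := measurable_bracket mw mz.
have ib : mu.-integrable setT (fun x => (bracket_integrand (w x) (z x))%:E).
  apply: (le_integrable measurableT _ _ (integrableD measurableT iw iz)).
    exact/measurable_EFinP.
  move=> x _; change (`|bracket_integrand (w x) (z x)|%:E <= `| `|w x| `^ q + `|z x| `^ q |%:E)%E.
  rewrite lee_fin (le_trans (bracket_integrand_bound _ _))//; exact: ler_norm.
rewrite (qbracketE mw mz ib) !fine_Lnorm_powR.
rewrite -RintegralZl// -RintegralD//; last first.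
  rewrite (_ : _ \o _ = fun x => (q * h)%:E * (bracket_integrand (w x) (z x))%:E)%E//.
  exact: integrableZl.
apply: le_Rintegral => //.
- rewrite (_ : _ \o _ = (fun x => (`|w x| `^ q)%:E + (q * h)%:E * (bracket_integrand (w x) (z x))%:E)%E)//.
  by apply: integrableD => //; exact: integrableZl.
- by move=> x _; exact: bracket_integrand_tangent.
Qed.

End bracket.

Section Ldist_theory.
Context d (T : measurableType d) (R : realType) (mu : {measure set T -> \bar R}).
Implicit Types (f g h : T -> R) (p : \bar R).

Lemma Ldist_ge0 p f g : (0 <= Ldist mu p f g)%E.
Proof. exact: Lnorm_ge0. Qed.

Lemma LdistC p f g : Ldist mu p f g = Ldist mu p g f.
Proof.
rewrite /Ldist -[RHS]oppe_Lnorm; apply: eq_Lnorm => x.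
by change ((f x - g x)%:E = (- (g x - f x))%:E); rewrite opprB.
Qed.

Lemma Ldist_triangle p g f h : (1 <= p)%E -> measurable_fun setT f ->
  measurable_fun setT g -> measurable_fun setT h ->
  (Ldist mu p f h <= Ldist mu p f g + Ldist mu p g h)%E.
Proof.
move=> p1 mf mg mh.
rewrite /Ldist (_ : f \- h = (f \- g) \+ (g \- h)).
  by apply: eminkowski => //; exact: measurable_funB.
by apply/funext => x /=; ring.
Qed.

Lemma Ldist_ae p f g f' g' : (1 <= p)%E -> measurable_fun setT f ->
  measurable_fun setT g -> measurable_fun setT f' -> measurable_fun setT g' ->
  f = f' %[ae mu] -> g = g' %[ae mu] -> Ldist mu p f g = Ldist mu p f' g'.
Proof.
move=> p1 mf mg mf' mg' ff gg; apply: Lnorm_ae => //; try exact: measurable_funB.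
by apply: filterS2 ff gg => x fx gx _ /=; rewrite fx// gx.
Qed.

Context p (p1 : (1 <= p)%E).
Implicit Types u v : LspaceType mu p1.

Lemma Ldist_eq0 u v : Ldist mu p u v = 0%E -> u = v.
Proof.
move=> /(Lnorm_eq0_ae p1 (measurable_LspaceB u v)) h.
by apply: Lspace_ae_inj; apply: filterS h => x /= hx _; apply/subr0_eq; exact: hx.
Qed.

Lemma Ldist_cvg_unique (w : nat -> LspaceType mu p1) u v :
  Ldist mu p (w n) u @[n --> \oo] --> 0%E -> Ldist mu p (w n) v @[n --> \oo] --> 0%E ->
  u = v.
Proof.
move=> wu wv; apply: Ldist_eq0; apply/eqP; rewrite eq_le Ldist_ge0 andbT.
have h : (Ldist mu p (w n) u + Ldist mu p (w n) v)%E @[n --> \oo] --> 0%E.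
  by rewrite -[X in _ --> X]adde0; apply: cvgeD.
apply: (cvge_to_ge h); apply: nearW => n.
by rewrite (LdistC p (w n) u); apply: Ldist_triangle => //; exact: Lspace_measurable.
Qed.

End Ldist_theory.

(** Carries an estimate in any norm from approximations to their L^p-limits; the slack [e] absorbs
    constants that converge only as n grows. *)
Lemma Ldist_lsc d (T : measurableType d) (R : realType) (mu : {measure set T -> \bar R})
    (p : R) (p1 : (1 <= p%:E)%E) (s : \bar R) (w w' : nat -> LspaceType mu p1)
    (u u' : LspaceType mu p1) (c : R) : (1 <= s)%E ->
  Ldist mu p%:E (w n) u @[n --> \oo] --> 0%E ->
  Ldist mu p%:E (w' n) u' @[n --> \oo] --> 0%E -> 0 <= c ->
  (forall e : R, 0 < e -> \forall n \near \oo, (Ldist mu s (w n) (w' n) <= (c + e)%:E)%E) ->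
  (Ldist mu s u u' <= c%:E)%E.
Proof.
move=> s1 wu wu' c0 h.
have m := @Lspace_measurable _ _ _ mu p%:E p1.
have mB v v' := @measurable_LspaceB _ _ _ mu p%:E p1 v v'.
apply: (@Lnorm_lsc _ _ _ mu p s (fun n => (w n : T -> R) \- w' n) (u \- u') c p1 s1
  (fun n => mB _ _) (mB _ _) _ c0 h).
have hh : (Ldist mu p%:E (w n) u + Ldist mu p%:E (w' n) u')%E @[n --> \oo] --> 0%E.
  by rewrite -[X in _ --> X]adde0; apply: cvgeD.
apply: (@squeeze_cvge _ _ _ _ (cst 0%E) _ _ _ _ _ hh); last exact: cvg_cst.
apply: nearW => n; rewrite Lnorm_ge0/=.
rewrite (_ : (_ \- _) \- _ = ((w n : T -> R) \- u) \+ ((u' : T -> R) \- w' n)); last first.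
  by apply/funext => x /=; ring.
by rewrite (LdistC _ _ (w' n)); apply: eminkowski.
Qed.

Section exponential_bounds.
Context {R : realType}.

(** 1 / (1 - x) = 1 + x / (1 - x) is at most the exponential of x / (1 - x). *)
Lemma expR_le_subr (x : R) : 0 <= x < 1 -> expR (- (x / (1 - x))) <= 1 - x.
Proof.
move=> /andP[x0 x1]; have x1' : 0 < 1 - x by rewrite subr_gt0.
rewrite expRN -[leRHS]invrK lef_pV2 ?posrE ?expR_gt0 ?invr_gt0//.
apply: le_trans (expR_ge1Dx _).
by rewrite le_eqVlt; apply/orP; left; apply/eqP; field; rewrite gt_eqF.
Qed.

Lemma invr_subr_exprn_le (x : R) n : 0 <= x < n%:R ->
  (1 - x / n%:R)^-1 ^+ n <= expR (x / (1 - x / n%:R)).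
Proof.
move=> /andP[x0 xn]; have n0 : (0 : R) < n%:R by exact: le_lt_trans xn.
have x1 : x / n%:R < 1 by rewrite ltr_pdivrMr// mul1r.
have b0 : 0 < 1 - x / n%:R by rewrite subr_gt0.
have h : expR (- (x / n%:R / (1 - x / n%:R))) <= 1 - x / n%:R.
  by apply: expR_le_subr; rewrite x1 divr_ge0.
have {}h : (1 - x / n%:R)^-1 <= expR (x / n%:R / (1 - x / n%:R)).
  by rewrite -[leRHS]invrK -expRN lef_pV2// posrE expR_gt0.
apply: (@le_trans _ _ (expR (x / n%:R / (1 - x / n%:R)) ^+ n)).
  by apply: lerXn2r => //; rewrite nnegrE ?expR_ge0// invr_ge0 ltW.
rewrite -expRM_natl ler_expR le_eqVlt; apply/orP; left; apply/eqP.
by field; rewrite !gt_eqF//= subr_gt0.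
Qed.

Lemma cvg_expR_div (x c : R) : expR (c / (1 - x / n%:R)) @[n --> \oo] --> expR c.
Proof.
apply: continuous_cvg; first exact: continuous_expR.
rewrite -[X in _ --> X]mulr1; apply: cvgM; first exact: cvg_cst.
rewrite -[X in _ --> X]invr1; apply: cvgV; first exact: oner_neq0.
rewrite -[X in _ --> X](subr0 1); apply: cvgB; first exact: cvg_cst.
rewrite -[X in _ --> X](mulr0 x); apply: cvgM; first exact: cvg_cst.
apply/cvgrPdist_lt => e e0; near=> n.
rewrite sub0r normrN ger0_norm ?invr_ge0//.
have n0 : (0 : R) < n%:R.
  by rewrite ltr0n; near: n; exact: nbhs_infty_gt.
rewrite -[ltRHS]invrK ltf_pV2 ?posrE ?invr_gt0//.
by near: n; exact: nbhs_infty_gtr.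
Unshelve. all: by end_near.
Qed.

End exponential_bounds.

(** * Dissipation along the implicit Euler scheme *)

Section implicit_Euler.
Context d (X : measurableType d) (R : realType) (mu : {measure set X -> \bar R}).
Context (q : R) (q1 : (1 <= q%:E)%E) (A : Lop mu q1) (omega : R).
Hypotheses (homega : 0 <= omega) (hA : completely_accretive (Lshift A omega)).
Context (r : \bar R) (r1 : (1 <= r)%E) (rho sigma C : R).
Hypotheses (hrho : 0 <= rho) (hsigma : 0 < sigma) (hC : 0 < C).
Hypothesis hGN : forall u v u' v' : LspaceType mu q1, A (u, v) -> A (u', v') ->
  (Ldist mu r u u' `^ sigma
    <= (C * (qbracket mu q (u \- u') (v \- v')
             + omega * fine (Ldist mu q%:E u u') `^ q)
        * fine (Ldist mu q%:E u u') `^ rho)%:E)%E.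
Implicit Types (f g u v : LspaceType mu q1) (h M : R).

(** The tangent inequality for the bracket gives q h G <= E, with [G] the bracket plus the
    omega-term, and the Gagliardo-Nirenberg hypothesis gives M^sigma <= C G Du^rho. A real lower
    bound [M] replaces the L^r-distance, whose finiteness then need not be discussed. *)
Lemma resolvent_dissipation h g g' u u' M : 0 < h ->
  resolvent A h g u -> resolvent A h g' u' -> 0 <= M -> (M%:E <= Ldist mu r u u')%E ->
  let E := fine (Ldist mu q%:E g g') `^ q
           - (1 - omega * q * h) * fine (Ldist mu q%:E u u') `^ q in
  0 <= E /\ h * (q / C) * M `^ sigma <= fine (Ldist mu q%:E u u') `^ rho * E.
Proof.
move=> h0 [v Auv gv] [v' Auv' gv'] M0 MN.
have q1' : 1 <= q by rewrite -lee_fin.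
have q0 : 0 < q by exact: lt_le_trans q1'.
have q0' : q != 0 by rewrite gt_eqF.
set Du := fine (Ldist mu q%:E u u'); set Dg := fine _ => E.
set G := qbracket mu q (u \- u') (v \- v') + omega * Du `^ q.
have hM : M `^ sigma <= C * G * Du `^ rho.
  rewrite -lee_fin -poweR_EFin; apply: le_trans (hGN Auv Auv').
  by apply: (gt0_ler_poweR (ltW hsigma)) => //; rewrite in_itv/= leey ?andbT// Ldist_ge0.
have hT : q * h * G <= E.
  have mB := @measurable_LspaceB _ _ _ mu q%:E q1.
  have fB := @Ldist_finite _ _ _ mu q%:E q1.
  have := @qbracket_tangent _ _ _ mu q q1' (u \- u') (v \- v') (g \- g') h (mB _ _) (mB _ _) (mB _ _)
     (fB _ _) (fB _ _) (fB _ _) h0.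
  rewrite -/Du -/Dg => H; have {}H : Du `^ q + q * h * qbracket mu q (u \- u') (v \- v') <= Dg `^ q.
    by apply: H; apply: filterS2 gv gv' => x hx hx' _ /=; rewrite hx// hx'//; ring.
  rewrite /E /G; lra.
have Dq : 0 <= Du `^ rho by exact: powR_ge0.
have M0' : 0 <= M `^ sigma by exact: powR_ge0.
have k0 : 0 < h * (q / C) by rewrite mulr_gt0// divr_gt0.
have [G0|G0] := leP 0 G.
  split; first by apply: le_trans hT; rewrite !mulr_ge0// ltW.
  apply: le_trans (ler_wpM2l Dq hT).
  rewrite [leRHS](_ : _ = h * (q / C) * (C * G * Du `^ rho)); last first.
    by field; rewrite gt_eqF.
  by rewrite ler_pM2l.
(* A negative [G] is compatible with the hypothesis only if Du^rho = 0; then [Du] and M^sigma vanish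
   and the claim is trivial. *)
have : Du `^ rho <= 0.
  rewrite leNgt; apply/negP => D0.
  by move: (le_trans M0' hM); apply/negP; rewrite -ltNge pmulr_llt0// nmulr_llt0// pmulr_rlt0.
move=> D0; have {D0}D0 : Du `^ rho = 0 by apply/eqP; rewrite eq_le D0.
have -> : M `^ sigma = 0.
  by apply/eqP; rewrite eq_le M0' andbT (le_trans hM)// D0 mulr0.
rewrite D0 mulr0 mul0r; split => //.
by rewrite /E (powR_eq0_eq0 D0) powR0// mulr0 subr0 powR_ge0.
Qed.

(** Induction on the number of steps. Dissipation weighted by a^k telescopes, where a = 1 - omega q
    h; each step also loses b^sigma, with b = 1 - omega h, from going back through the
    L^r-contraction, and b^rho from replacing the current L^q-distance by the initial one. *)
Lemma Euler_smoothing h n f f' u u' M : 0 < h -> omega * q * h < 1 ->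
  resolvent_iter A h n f u -> resolvent_iter A h n f' u' ->
  0 <= M -> (M%:E <= Ldist mu r u u')%E ->
  n%:R * (h * (q / C)) * ((1 - omega * q * h) * (1 - omega * h) `^ (sigma + rho)) ^+ n * M `^ sigma
  <= fine (Ldist mu q%:E f f') `^ rho *
   (fine (Ldist mu q%:E f f') `^ q - (1 - omega * q * h) ^+ n * fine (Ldist mu q%:E u u') `^ q).
Proof.
move=> h0 oqh.
have q1' : 1 <= q by rewrite -lee_fin.
have q0 : 0 < q by exact: lt_le_trans q1'.
have oh : omega * h <= omega * q * h.
  by rewrite ler_wpM2r ?(ltW h0)// ler_peMr.
have oh1 : omega * h < 1 by exact: le_lt_trans oh oqh.
have oh0 : 0 <= omega * h by rewrite mulr_ge0// ltW.
set a := 1 - omega * q * h; set b := 1 - omega * h.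
have a0 : 0 < a by rewrite subr_gt0.
have a1 : a <= 1 by rewrite gerBl (le_trans oh0).
have b0 : 0 < b by rewrite subr_gt0.
have b1 : b <= 1 by rewrite gerBl.
have bp (x : R) : 0 <= x -> 0 <= b `^ x <= 1.
  move=> x0; rewrite powR_ge0 /= -(powRr0 b); apply: ger_powR => //; by rewrite b0.
rewrite powRD; last by apply/implyP => _; rewrite gt_eqF.
set Bs := b `^ sigma; set Br := b `^ rho.
have /andP[Bs0 Bs1] : 0 <= Bs <= 1 by apply: bp; exact: ltW.
have /andP[Br0 Br1] : 0 <= Br <= 1 by exact: bp.
have k0 : 0 < h * (q / C) by rewrite mulr_gt0// divr_gt0.
set k := h * (q / C) in k0 *.
set D0 := fine (Ldist mu q%:E f f').
have D00 : 0 <= D0 by rewrite fine_ge0// Ldist_ge0.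
elim: n u u' M => [u u' M /= -> -> _ _|n IH u u' M ru ru' M0 MN].
  by rewrite !mul0r expr0 mul1r subrr mulr0.
have ruc := resolvent_iter_contraction hA h0 oh1 ru ru' q1.
case: ru ru' => g ig rg [g' ig' rg'].
(* [M] bounds the last L^r-distance from below, so [b * M] bounds the preceding one: the induction
   hypothesis is used with that value. *)
have bMN : ((b * M)%:E <= Ldist mu r g g')%E.
  have := le_trans MN (resolvent_contraction hA h0 oh1 rg rg' r1).
  rewrite -/b EFinM => hM.
  have b0' : (0 <= b%:E)%E by rewrite lee_fin ltW.
  have := lee_wpmul2l b0' hM.
  by rewrite muleA -(EFinM b b^-1) mulfV ?gt_eqF// mul1e.
have bM0 : 0 <= b * M by rewrite mulr_ge0// ltW.
have {IH}IH := IH _ _ _ ig ig' bM0 bMN.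
have diss := resolvent_dissipation h0 rg rg' M0 MN.
move: IH diss; rewrite -/k -/a.
set Dg := fine (Ldist mu q%:E g g'); set Du := fine (Ldist mu q%:E u u').
move=> IH [E0 diss].
have Ms0 : 0 <= M `^ sigma by exact: powR_ge0.
have eM : (b * M) `^ sigma = Bs * M `^ sigma by rewrite powRM// ltW.
have D0r : 0 <= D0 `^ rho by exact: powR_ge0.
have hDu : Br ^+ n.+1 * Du `^ rho <= D0 `^ rho.
  have : b ^+ n.+1 * Du <= D0.
    rewrite -lee_fin EFinM Ldist_fineK Ldist_fineK.
    have bn : (0 <= (b ^+ n.+1)%:E)%E by rewrite lee_fin exprn_ge0// ltW.
    have := lee_wpmul2l bn ruc.
    by rewrite muleA -(EFinM (b ^+ _)) -exprMn mulfV ?gt_eqF// expr1n mul1e.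
  move=> hb; have Du0 : 0 <= Du by rewrite fine_ge0// Ldist_ge0.
  have := ge0_ler_powR hrho _ _ hb.
  rewrite !nnegrE D00 mulr_ge0 ?exprn_ge0 ?(ltW b0)// => /(_ isT isT).
  rewrite powRM ?exprn_ge0 ?(ltW b0)//.
  have -> : (b ^+ n.+1) `^ rho = Br ^+ n.+1.
    by rewrite -[b ^+ _]powR_mulrn ?(ltW b0)// powRAC powR_mulrn// powR_ge0.
  by [].
have Dr0 : 0 <= Du `^ rho by exact: powR_ge0.
set E := Dg `^ q - a * Du `^ q in E0 diss.
have e1 : k * (a * (Bs * Br)) ^+ n.+1 * M `^ sigma <= D0 `^ rho * (a ^+ n * E).
  have an0 : 0 <= a ^+ n.+1 by rewrite exprn_ge0// ltW.
  have bn0 : 0 <= Bs ^+ n.+1 by rewrite exprn_ge0.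
  have cn0 : 0 <= Br ^+ n.+1 by rewrite exprn_ge0.
  have bn1 : Bs ^+ n.+1 <= 1 by rewrite exprn_ile1.
  have an1 : a ^+ n.+1 <= a ^+ n by rewrite exprS ler_piMl// exprn_ge0// ltW.
  apply: (@le_trans _ _ (a ^+ n.+1 * Bs ^+ n.+1 * (Br ^+ n.+1 * Du `^ rho) * E)).
    rewrite [leLHS](_ : _ = a ^+ n.+1 * Bs ^+ n.+1 * Br ^+ n.+1 * (k * M `^ sigma)); last first.
      by rewrite !exprMn; ring.
    rewrite [leRHS](_ : _ = a ^+ n.+1 * Bs ^+ n.+1 * Br ^+ n.+1 * (Du `^ rho * E)); last by ring.
    by apply: ler_wpM2l => //; rewrite !mulr_ge0.
  rewrite [leRHS]mulrA [D0 `^ rho * _]mulrC; apply: ler_wpM2r => //.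
  apply: ler_pM => //; first exact: mulr_ge0.
    exact: mulr_ge0.
  rewrite -[leRHS]mulr1; exact: ler_pM.
(* The n earlier steps: (b M)^sigma supplies the missing factor b^sigma, and the remaining a b^rho
   is at most 1. *)
have e2 : n%:R * k * (a * (Bs * Br)) ^+ n.+1 * M `^ sigma <=
   n%:R * k * (a * (Bs * Br)) ^+ n * (b * M) `^ sigma.
  rewrite eM exprS.
  set eta := _ ^+ n.
  have -> : n%:R * k * (a * (Bs * Br) * eta) * M `^ sigma
    = n%:R * k * (eta * (Bs * M `^ sigma) * (a * Br)) by ring.
  rewrite -[leRHS]mulrA; apply: ler_wpM2l; first by rewrite mulr_ge0// ltW.
  have e0 : 0 <= a * (Bs * Br) by rewrite !mulr_ge0// ltW.
  apply: ler_piMr; first by apply: mulr_ge0; [exact: exprn_ge0|exact: mulr_ge0].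
  by rewrite -[leRHS]mulr1 ler_pM// ltW.
have -> : n.+1%:R * k * (a * (Bs * Br)) ^+ n.+1 * M `^ sigma =
   n%:R * k * (a * (Bs * Br)) ^+ n.+1 * M `^ sigma + k * (a * (Bs * Br)) ^+ n.+1 * M `^ sigma.
  by rewrite -natr1; ring.
apply: (le_trans (lerD (le_trans e2 IH) e1)).
by rewrite -mulrDr ler_wpM2l// /E exprSr; lra.
Qed.
End implicit_Euler.

(** * The semigroup *)

Section semigroup.
Context d (X : measurableType d) (R : realType) (mu : {measure set X -> \bar R}).
Context (q : R) (q1 : (1 <= q%:E)%E) (A : Lop mu q1) (omega : R).
Hypotheses (homega : 0 <= omega) (hA : completely_accretive (Lshift A omega)).
Hypothesis hdense : Lclosure (Ldom A) = setT.
Context (S : R -> LspaceType mu q1 -> LspaceType mu q1) (hS : semigroup_generated A S).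
Implicit Types (u v : LspaceType mu q1) (t : R).

Lemma semigroup_iterates t u : 0 < t -> exists2 w : nat -> LspaceType mu q1,
  \forall n \near \oo, resolvent_iter A (t / n%:R) n u (w n) &
  Ldist mu q%:E (w n) (S t u) @[n --> \oo] --> 0%E.
Proof.
move=> t0; have Du : Lclosure (Ldom A) u by rewrite hdense.
exact: (hS Du).2.
Qed.

Lemma near_small_step (c t : R) : \forall n \near \oo, c * (t / n%:R) < 1 /\ (0 < n)%N.
Proof.
near=> n.
have n0 : (0 < n)%N by near: n; exact: nbhs_infty_gt.
split => //; rewrite mulrA ltr_pdivrMr ?ltr0n// mul1r.
by near: n; exact: nbhs_infty_gtr.
Unshelve. all: by end_near.
Qed.

Lemma near_expR_div (x c P e : R) : 0 < e ->
  \forall n \near \oo, P * expR (c / (1 - x / n%:R)) <= P * expR c + e.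
Proof.
move=> e0.
have h : P * expR (c / (1 - x / n%:R)) @[n --> \oo] --> P * expR c.
  by apply: cvgM; [exact: cvg_cst|exact: cvg_expR_div].
have {}h := @cvgr_le R nat \oo _ _ _ h (P * expR c + e).
by apply: h; rewrite ltrDl.
Qed.

Lemma near_contraction_factor t P e : 0 < t -> 0 <= P -> 0 < e ->
  \forall n \near \oo,
    P * (1 - omega * (t / n%:R))^-1 ^+ n <= P * expR (omega * t) + e.
Proof.
move=> t0 P0 e0; near=> n.
have [otn n0] : omega * (t / n%:R) < 1 /\ (0 < n)%N by near: n; exact: near_small_step.
apply: (@le_trans _ _ (P * expR (omega * t / (1 - omega * t / n%:R)))).
  rewrite ler_wpM2l// mulrA; apply: invr_subr_exprn_le.
  by move: otn; rewrite mulrA ltr_pdivrMr ?ltr0n// mul1r => ->; rewrite mulr_ge0// ltW.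
by near: n; exact: near_expR_div.
Unshelve. all: by end_near.
Qed.

(** Limit of n resolvent contractions of step t / n by lower semicontinuity, for exponents s
    unrelated to q. *)
Lemma semigroup_contraction t u u' (s : \bar R) : 0 < t -> (1 <= s)%E ->
  (Ldist mu s (S t u) (S t u') <= (expR (omega * t))%:E * Ldist mu s u u')%E.
Proof.
move=> t0 s1.
have : (0 <= Ldist mu s u u')%E by exact: Ldist_ge0.
case El : (Ldist mu s u u') => [l| |]// l0; last first.
  by rewrite gt0_muley ?leey// lte_fin expR_gt0.
rewrite lee_fin in l0.
have [w wi wc] := semigroup_iterates u t0.
have [w' wi' wc'] := semigroup_iterates u' t0.
rewrite -EFinM; apply: (Ldist_lsc s1 wc wc'); first by rewrite mulr_ge0// expR_ge0.
move=> e e0; near=> n.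
have [otn n0] : omega * (t / n%:R) < 1 /\ (0 < n)%N by near: n; exact: near_small_step.
have n0' : (0 : R) < n%:R by rewrite ltr0n.
have tn0 : 0 < t / n%:R by rewrite divr_gt0.
have win : resolvent_iter A (t / n%:R) n u (w n) by near: n.
have win' : resolvent_iter A (t / n%:R) n u' (w' n) by near: n.
apply: le_trans (resolvent_iter_contraction hA tn0 otn win win' s1) _.
rewrite El -EFinM lee_fin mulrC [expR _ * _]mulrC.
by near: n; exact: near_contraction_factor.
Unshelve. all: by end_near.
Qed.

(* The [(n + 2) k]-th iterate of step [t / k] is the [k]-th iterate started at the
   [(n + 1) k]-th one, which approximates [S ((n + 1) t) u]. *)
Lemma semigroup_add t n u : 0 < t ->
  S (n.+2%:R * t) u = S t (S (n.+1%:R * t) u).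
Proof.
move=> t0; set z := S (n.+1%:R * t) u.
have nt0 k : 0 < k.+1%:R * t by rewrite mulr_gt0.
have [w wi wc] := semigroup_iterates u (nt0 n.+1).
have [w' wi' wc'] := semigroup_iterates u (nt0 n).
have [w2 wi2 wc2] := semigroup_iterates z t0.
have step k j : (0 < k)%N -> j.+1%:R * t / (j.+1 * k)%:R = t / k%:R.
  by move=> k0; rewrite natrM -mulf_div divff ?mul1r// pnatr_eq0.
have sub j (P : nat -> Prop) : (\forall k \near \oo, P k) -> \forall k \near \oo, P (j.+1 * k)%N.
  by move=> [N _ NP]; exists N => // k /= Nk; apply: NP => /=; rewrite (leq_trans Nk)// leq_pmull.
have subc j (v : nat -> LspaceType mu q1) z' : Ldist mu q%:E (v k) z' @[k --> \oo] --> 0%E ->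
    Ldist mu q%:E (v (j.+1 * k)%N) z' @[k --> \oo] --> 0%E.
  by move=> vz B /vz /(sub j).
apply: (@Ldist_cvg_unique _ _ _ mu q%:E q1 (fun k => w (n.+2 * k)%N)); first exact: subc.
(* Majorant: the contraction carries the error of [w'] at time (n + 1) t through k more steps, by a
   factor at most e^(omega t) + 1 for large k, and [w2] converges to S t z. *)
have hh : ((expR (omega * t) + 1)%:E * Ldist mu q%:E (w' (n.+1 * k)%N) z
    + Ldist mu q%:E (w2 k) (S t z))%E @[k --> \oo] --> 0%E.
  rewrite -[X in _ --> X]adde0; apply: cvgeD => //.
  rewrite -[X in _ --> X](mule0 (expR (omega * t) + 1)%:E).
  by apply: cvgeZl => //; exact: subc.
apply: (@squeeze_cvge _ _ _ _ (cst 0%E) _ _ _ _ _ hh); last exact: cvg_cst.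
have wik := sub n.+1 _ wi; have wik' := sub n _ wi'.
near=> k; rewrite Ldist_ge0/=.
have [otk k0] : omega * (t / k%:R) < 1 /\ (0 < k)%N by near: k; exact: near_small_step.
have k0' : (0 : R) < k%:R by rewrite ltr0n.
have tk0 : 0 < t / k%:R by rewrite divr_gt0.
apply: (@le_trans _ _ (Ldist mu q%:E (w (n.+2 * k)%N) (w2 k) + Ldist mu q%:E (w2 k) (S t z))%E).
  by apply: Ldist_triangle => //; exact: Lspace_measurable.
apply: leeD2r.
have wk : resolvent_iter A (t / k%:R) (n.+2 * k) u (w (n.+2 * k)%N).
  by rewrite -(step k n.+1)//; near: k; exact: wik.
have wk' : resolvent_iter A (t / k%:R) (n.+1 * k) u (w' (n.+1 * k)%N).
  by rewrite -(step k n)//; near: k; exact: wik'.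
have wk2 : resolvent_iter A (t / k%:R) k z (w2 k) by near: k.
rewrite mulSn in wk.
have [g ug gw] := resolvent_iter_add wk.
(* Iterates are unique, so the intermediate point of the long chain is the one given by [w']. *)
have eg := resolvent_iter_inj hA tk0 otk ug wk'; subst g.
apply: le_trans (resolvent_iter_contraction hA tk0 otk gw wk2 q1) _.
apply: lee_wpmul2r; first exact: Ldist_ge0.
rewrite lee_fin -[leLHS]mul1r -[expR _]mul1r.
by near: k; exact: near_contraction_factor.
Unshelve. all: by end_near.
Qed.

(** This form of the semigroup law is all that halving a time and splitting it into equal parts
    require. *)
Lemma semigroup_iter t n u : 0 < t -> S (n.+1%:R * t) u = iter n.+1 (S t) u.
Proof.
move=> t0; elim: n => [|n IH]; first by rewrite mul1r.
by rewrite semigroup_add// IH.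
Qed.

(** * Smoothing from L^q to L^r *)

Section smoothing.
Context (r : \bar R) (r1 : (1 <= r)%E) (rho sigma C : R).
Hypotheses (hrho : 0 <= rho) (hsigma : 0 < sigma) (hC : 0 < C).
Hypothesis hGN : forall u v u' v' : LspaceType mu q1, A (u, v) -> A (u', v') ->
  (Ldist mu r u u' `^ sigma
    <= (C * (qbracket mu q (u \- u') (v \- v')
             + omega * fine (Ldist mu q%:E u u') `^ q)
        * fine (Ldist mu q%:E u u') `^ rho)%:E)%E.

(** [Euler_smoothing] with h = t / n, so that n h = t: the subtracted term is dropped, the sigma-th
    root is taken, and the product of the factors is bounded by an exponential whose rate
    converges. *)
Lemma semigroup_smoothing t u u' : 0 < t ->
  (Ldist mu r (S t u) (S t u')
      <= ((C / q) `^ sigma^-1 * t `^ (- sigma^-1) * expR (omega * ((q + rho) / sigma + 1) * t)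
          * fine (Ldist mu q%:E u u') `^ ((q + rho) / sigma))%:E)%E.
Proof.
move=> t0.
have q1' : 1 <= q by rewrite -lee_fin.
have q0 : 0 < q by exact: lt_le_trans q1'.
have [w wi wc] := semigroup_iterates u t0.
have [w' wi' wc'] := semigroup_iterates u' t0.
set D0 := fine (Ldist mu q%:E u u').
have D00 : 0 <= D0 by rewrite fine_ge0// Ldist_ge0.
set P := (C / q) `^ sigma^-1 * t `^ (- sigma^-1) * D0 `^ ((q + rho) / sigma).
have P0 : 0 <= P by rewrite !mulr_ge0// powR_ge0.
set K := omega * ((q + rho) / sigma + 1) * t.
rewrite (_ : _ * _ * _ * _ = P * expR K); last by rewrite /P; ring.
apply: (Ldist_lsc r1 wc wc'); first by rewrite mulr_ge0// expR_ge0.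
move=> e e0; near=> n.
have [oqt n0] : omega * q * (t / n%:R) < 1 /\ (0 < n)%N by near: n; exact: near_small_step.
have n0' : (0 : R) < n%:R by rewrite ltr0n.
have tn0 : 0 < t / n%:R by rewrite divr_gt0.
have win : resolvent_iter A (t / n%:R) n u (w n) by near: n.
have win' : resolvent_iter A (t / n%:R) n u' (w' n) by near: n.
set c := P * expR (K / (1 - omega * q * t / n%:R)).
apply: (@le_trans _ _ c%:E); last by rewrite lee_fin /c; near: n; exact: near_expR_div.
have c0 : 0 <= c by rewrite mulr_ge0// expR_ge0.
(* Real lower bounds suffice: an infinite distance would admit M = c + 1. *)
suff hM (M : R) : 0 <= M -> (M%:E <= Ldist mu r (w n) (w' n))%E -> M <= c.
  have := Ldist_ge0 mu r (w n) (w' n).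
  case: (Ldist mu r (w n) (w' n)) hM => [x| |]// hM x0.
    by rewrite lee_fin; apply: hM; rewrite lee_fin in x0 *.
  by have := hM (c + 1) (addr_ge0 c0 ler01) (leey _); rewrite leNgt ltrDl ltr01.
move=> M0 /(Euler_smoothing homega hA r1 hrho hsigma hC hGN tn0 oqt win win' M0).
rewrite -/D0.
set x := omega * (t / n%:R).
have x0 : 0 <= x by rewrite mulr_ge0// ltW.
have eqx : omega * q * (t / n%:R) = q * x by rewrite /x; ring.
rewrite eqx -/x; rewrite eqx in oqt.
have xq : x <= q * x by rewrite ler_peMl.
have -> : n%:R * (t / n%:R * (q / C)) = t * (q / C) by field; rewrite !gt_eqF.
move=> H.
set a := 1 - q * x in H; set b := 1 - x in H.
have a0 : 0 < a by rewrite subr_gt0.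
have b0 : 0 < b by rewrite subr_gt0 (le_lt_trans xq).
have ea : expR (- (q * x / a)) <= a by apply: expR_le_subr; rewrite oqt mulr_ge0// ltW.
(* The smaller denominator a <= b is used for both factors, so that over n steps their exponents add
   up to K sigma / a. *)
have eb : expR (- (x / a)) <= b.
  apply: (@le_trans _ _ (expR (- (x / b)))).
    by rewrite ler_expR lerN2 ler_wpM2l// lef_pV2 ?posrE// lerD2l lerN2.
  by apply: expR_le_subr; rewrite x0 (le_lt_trans xq).
have sr0 : 0 <= sigma + rho by rewrite addr_ge0// ltW.
set E := expR (- (K * sigma / a)).
have hE : E <= (a * b `^ (sigma + rho)) ^+ n.
  have -> : E = (expR (- (q * x / a)) * expR (- (x / a)) `^ (sigma + rho)) ^+ n.
    rewrite -expRM -expRD -expRM_natl /E /K /x; congr expR.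
    by field; rewrite !gt_eqF.
  apply: lerXn2r; rewrite ?nnegrE ?mulr_ge0 ?expR_ge0 ?powR_ge0 ?(ltW a0)//.
  apply: ler_pM => //; rewrite ?expR_ge0 ?powR_ge0//.
  by apply: ge0_ler_powR => //; rewrite nnegrE ?expR_ge0// ltW.
have Ms0 : 0 <= M `^ sigma by exact: powR_ge0.
have tq0 : 0 < t * (q / C) by rewrite mulr_gt0// divr_gt0.
have hMs : M `^ sigma <= (C / q) * t^-1 * expR (K * sigma / a) * D0 `^ (q + rho).
  have H2 : t * (q / C) * E * M `^ sigma <= D0 `^ (q + rho).
    apply: (@le_trans _ _ (t * (q / C) * (a * b `^ (sigma + rho)) ^+ n * M `^ sigma)).
      by apply: ler_wpM2r => //; apply: ler_wpM2l => //; exact: ltW.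
    apply: le_trans H _.
    rewrite [q + rho]addrC powRD; last by rewrite gt_eqF// ltr_wpDl.
    by rewrite ler_wpM2l ?powR_ge0// gerBl mulr_ge0 ?powR_ge0// exprn_ge0// ltW.
  have E0 : 0 < E by exact: expR_gt0.
  have -> : expR (K * sigma / a) = E^-1 by rewrite /E expRN invrK.
  have tqE : 0 < t * (q / C) * E by rewrite mulr_gt0.
  have tqEi : 0 <= (t * (q / C) * E)^-1 by rewrite invr_ge0 ltW.
  have := ler_wpM2l tqEi H2.
  have -> : (t * (q / C) * E)^-1 * (t * (q / C) * E * M `^ sigma) = M `^ sigma.
    by rewrite mulKf// gt_eqF.
  move/le_trans; apply; rewrite le_eqVlt; apply/orP; left; apply/eqP.
  by field; rewrite !gt_eqF.
have -> : M = M `^ sigma `^ sigma^-1 by rewrite -powRrM mulfV ?gt_eqF// powRr1.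
have si0 : 0 <= sigma^-1 by rewrite invr_ge0 ltW.
have C0 : 0 <= C / q by rewrite ltW// divr_gt0.
have t1 : 0 <= t^-1 by rewrite invr_ge0 ltW.
have Cte0 : 0 <= C / q * t^-1 * expR (K * sigma / a).
  by apply: mulr_ge0; [exact: mulr_ge0|exact: expR_ge0].
have R0 : 0 <= C / q * t^-1 * expR (K * sigma / a) * D0 `^ (q + rho).
  by rewrite mulr_ge0// powR_ge0.
have {}hMs : (M `^ sigma) `^ sigma^-1 <= (C / q * t^-1 * expR (K * sigma / a) * D0 `^ (q + rho)) `^ sigma^-1.
  by apply: ge0_ler_powR.
apply: (le_trans hMs).
have Ct0 : 0 <= C / q * t^-1 by exact: mulr_ge0.
rewrite (powRM _ Cte0 (powR_ge0 _ _)) (powRM _ Ct0 (expR_ge0 _)) (powRM _ C0 t1).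
have -> : t^-1 `^ sigma^-1 = t `^ (- sigma^-1).
  by rewrite -[t^-1]powR_inv1 ?ltW// -powRrM mulN1r.
rewrite -powRrM -expRM /c /P /K.
rewrite (_ : omega * q * t / n%:R = q * x) -/a; last by rewrite -eqx mulrA.
rewrite (_ : _ * sigma / a * sigma^-1 = omega * ((q + rho) / sigma + 1) * t / a); last first.
  by field; rewrite !gt_eqF.
by rewrite le_eqVlt; apply/orP; left; apply/eqP; ring.
Unshelve. all: by end_near.
Qed.

End smoothing.
End semigroup.

(** * De Giorgi iteration *)

Section truncation.
Context {R : realType}.
Implicit Types (l x p q delta H : R).

Definition clip l x := Num.max (- l) (Num.min l x).

Lemma norm_clip l x : 0 <= l -> `|clip l x| <= l.
Proof.
move=> l0; rewrite /clip ler_norml le_max lexx /= ge_max ge_min lexx /= andbT.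
by rewrite (le_trans _ l0)// oppr_le0.
Qed.

Lemma norm_clip_le l x : 0 <= l -> `|clip l x| <= `|x|.
Proof.
move=> l0; rewrite /clip ler_norml le_max ge_max ge_min ler_norm orbT andbT.
have := ler_norm x; have := ler_norm (- x); rewrite normrN => h1 h2.
apply/andP; split.
  by apply/orP; right; rewrite le_min; apply/andP; split; lra.
by rewrite (le_trans _ (normr_ge0 x))// oppr_le0.
Qed.

Lemma norm_sub_clip l x : 0 <= l -> `|x - clip l x| = Num.max (`|x| - l) 0.
Proof.
move=> l0; rewrite /clip.
case: (lerP l x) => lx.
  rewrite max_r; last by lra.
  by rewrite !ger0_norm ?subr_ge0 ?(le_trans l0)// max_l// subr_ge0.
case: (lerP (- l) x) => lx'.
  rewrite subrr normr0 max_r// subr_le0 ler_norml; lra.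
have x0 : x < 0 by lra.
rewrite (ltr0_norm x0) max_l ?ltr0_norm; lra.
Qed.

(** Nonzero only for l < |x| <= H, where |x|^q = |x|^(-delta) |x|^(q-p+delta) |x|^p: the first
    factor is bounded through l, the second through H. The parameter delta makes both exponents
    usable for any order of p and q. *)
Lemma norm_sub_clip_powR l x p q delta H : 1 <= q -> 0 < l -> 0 < H -> `|x| <= H ->
  0 <= delta -> 0 <= q - p + delta ->
  `|x - clip l x| `^ q <= l `^ (- delta) * H `^ (q - p + delta) * `|x| `^ p.
Proof.
move=> q1 l0 H0 xH d0 qpd.
have q0 : 0 < q by lra.
rewrite norm_sub_clip ?(ltW l0)//.
have [xl|lx] := leP `|x| l.
  rewrite max_r ?subr_le0// powR0 ?gt_eqF// mulr_ge0 ?powR_ge0// mulr_ge0 ?powR_ge0//.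
have x0 : 0 < `|x| by exact: lt_trans lx.
rewrite max_l ?subr_ge0 ?(ltW lx)//.
apply: (@le_trans _ _ (`|x| `^ q)).
  by apply: (ge0_ler_powR (ltW q0)); rewrite ?nnegrE ?subr_ge0 ?(ltW lx)// gerBl ltW.
have -> : `|x| `^ q = `|x| `^ (- delta) * `|x| `^ (q - p + delta) * `|x| `^ p.
  rewrite -!powRD ?(gt_eqF x0) ?implybT//; congr (_ `^ _); ring.
apply: ler_wpM2r; first exact: powR_ge0.
apply: ler_pM; rewrite ?powR_ge0//; last first.
  by apply: ge0_ler_powR => //; rewrite nnegrE ltW.
rewrite !powRN lef_pV2 ?posrE ?powR_gt0//.
by apply: (ge0_ler_powR d0); rewrite ?nnegrE ?(ltW l0) ?(ltW x0) ?(ltW lx).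
Qed.

Lemma measurable_clip d (T : measurableType d) l (f : T -> R) :
  measurable_fun setT f -> measurable_fun setT (fun y => clip l (f y)).
Proof.
move=> mf; apply: measurable_maxr; first exact: measurable_cst.
by apply: measurable_minr => //; exact: measurable_cst.
Qed.

End truncation.

Section Lspace_truncation.
Context d (T : measurableType d) (R : realType) (mu : {measure set T -> \bar R}).
Context (q : R) (q1 : (1 <= q%:E)%E).
Implicit Types (u v : LspaceType mu q1) (l H : R).

(** v = u' + clip (u - u'), so u - v is the part of u - u' beyond the level. The same v serves every
    [p], [delta] and [Y]. *)
Lemma Lspace_clip u u' l H : 0 < l -> 0 < H ->
  (Ldist mu +oo u u' <= H%:E)%E -> exists v : LspaceType mu q1,
  [/\ (Ldist mu +oo u' v <= l%:E)%E,
      (Ldist mu +oo u v <= Ldist mu +oo u u')%E &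
      forall p delta Y : R, 1 <= p -> 0 <= delta -> 0 <= q - p + delta -> 0 <= (Y : R) ->
        (Ldist mu p%:E u u' <= Y%:E)%E ->
        fine (Ldist mu q%:E u v) `^ q <= l `^ (- delta) * H `^ (q - p + delta) * Y `^ p].
Proof.
move=> l0 H0 uH.
have q1' : 1 <= q by rewrite -lee_fin.
have mL w := @Lspace_measurable _ _ _ mu q%:E q1 w.
have mB := @measurable_LspaceB _ _ _ mu q%:E q1.
pose c x := clip l (u x - u' x).
have mc : measurable_fun setT c by apply: measurable_clip; exact: mB.
have fc : finite_norm mu q%:E c.
  apply: le_lt_trans (Ldist_finite u u'); apply: le_Lnorm => //.
  by apply: nearW => x; exact: norm_clip_le (ltW l0).
have [v hv] : exists v : LspaceType mu q1, (v : T -> R) = (u' : T -> R) \+ c %[ae mu].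
  by apply: Lspace_surj; [exact: measurable_funD|apply: finite_normD => //; exact: Lspace_finite].
have ew : \forall x \ae mu, `|u x - v x| = `|(u x - u' x) - clip l (u x - u' x)|.
  by apply: filterS hv => x hx; rewrite hx//= /c; congr `|_|; ring.
exists v; split.
- apply/Lnormy_leP; first exact: ltW.
  by apply: filterS hv => x hx /=; rewrite hx//= /c opprD addNKr normrN norm_clip// ltW.
- apply: le_Lnorm; [exact: leey|exact: mB|exact: mB|]; apply: filterS ew => x /= ->.
  by rewrite (norm_sub_clip _ (ltW l0)) ge_max normr_ge0 andbT gerBl ltW.
move=> p delta Y p1 d0 qpd Y0 hY.
have uH' : \forall x \ae mu, `|u x - u' x| <= H by apply/(Lnormy_leP _ _ (ltW H0)).
have p0 : 0 < p by exact: lt_le_trans p1.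
set K := l `^ (- delta) * H `^ (q - p + delta).
have K0 : 0 <= K by rewrite mulr_ge0 ?powR_ge0.
rewrite -lee_fin -poweR_EFin Ldist_fineK Lnorm_powR ?gt_eqF ?(lt_le_trans ltr01)//.
apply: (@le_trans _ _ (\int[mu]_x (K%:E * (`|(u \- u') x| `^ p)%:E))%E).
  apply: ae_ge0_le_integral => //.
  - by apply: measurable_abs_powR.
  - by move=> x _; rewrite mule_ge0 ?lee_fin ?powR_ge0.
  - by apply: measurable_funeM; exact: measurable_abs_powR.
  - apply: filterS2 uH' ew => x xH ex _; rewrite -EFinM lee_fin /= ex.
    exact: norm_sub_clip_powR.
rewrite ge0_integralZl_EFin//; last exact: measurable_abs_powR.
rewrite (EFinM K); apply: lee_wpmul2l; first by rewrite lee_fin.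
by rewrite -Lnorm_leP.
Qed.

End Lspace_truncation.

(** * The iteration over halved times and levels *)

Section DeGiorgi.
Context d (X : measurableType d) (R : realType) (mu : {measure set X -> \bar R}).
Context (q : R) (q1 : (1 <= q%:E)%E) (r sigma gamma omega beta c : R).
Hypotheses (r1 : (1 <= r%:E)%E) (hsigma : 0 < sigma) (hgamma : 0 < gamma)
  (homega : 0 <= omega) (hbeta : 0 <= beta) (hc : 0 < c) (hkappa : q < gamma * r).
Context (F : R -> LspaceType mu q1 -> LspaceType mu q1).
Hypothesis F_smoothing : forall t u u', 0 < t ->
  (Ldist mu r%:E (F t u) (F t u') <= (c * t `^ (- sigma^-1) * expR (omega * beta * t)
     * fine (Ldist mu q%:E u u') `^ gamma)%:E)%E.
Hypothesis F_contraction : forall t u u' (s : \bar R), 0 < t -> (1 <= s)%E ->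
  (Ldist mu s (F t u) (F t u') <= (expR (omega * t))%:E * Ldist mu s u u')%E.
Hypothesis F_iter : forall t n u, 0 < t -> F (n.+1%:R * t) u = iter n.+1 (F t) u.
Implicit Types (u v : LspaceType mu q1) (t L : R).

Let kappa := gamma * r / q.
Let l2 := ln (2 : R).

Let q0 : 0 < q.
Proof. by rewrite -lte_fin (lt_le_trans _ q1). Qed.

Let r0 : 0 < r.
Proof. by rewrite -lte_fin (lt_le_trans _ r1). Qed.

Let k1 : 0 < kappa - 1.
Proof. by rewrite subr_gt0 ltr_pdivlMr// mul1r. Qed.

Lemma F_halves t u : 0 < t -> F t u = F (t / 2) (F (t / 2) u).
Proof.
move=> t0; have := @F_iter (t / 2) 1 u; rewrite divr_gt0// => /(_ isT) /= <-.
by congr F; field.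
Qed.

Section levels.
Context (delta eps eta : R).
Hypotheses (hdelta : 0 <= delta) (hrdelta : 0 <= q - r + delta).

(* Logarithm of the threshold for the q-th power of the L^q-norm, as a function of
   [ln t] and [ln L]: the power law, with the constant, for which one step of the
   iteration maps the threshold at [(t, L)] to the one at [(t / 2, L / 2)].  Here
   [expR eta] bounds the L^oo-norms and [expR eps] the factors [e^(omega beta t)]. *)
Definition level_exponent (lt lL : R) : R :=
  (- ((r / sigma + delta) / (kappa - 1) * l2) - r * ln c - r / sigma * l2
    - 2 * delta * l2 - r * eps) / (kappa - 1)
  + r / (sigma * (kappa - 1)) * lt + delta / (kappa - 1) * lL
  - (q - r + delta) / (kappa - 1) * eta.

(** Logarithm of the L^r-bound that smoothing gives for data at the threshold. *)
Definition decay_exponent (lt lL : R) : R :=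
  ln c - sigma^-1 * lt + eps + gamma / q * level_exponent lt lL.

Lemma F_smoothing_exp t u u' z : 0 < t -> omega * beta * t <= eps ->
  fine (Ldist mu q%:E u u') `^ q <= expR z ->
  (Ldist mu r%:E (F t u) (F t u') <=
    (expR (ln c - sigma^-1 * ln t + eps + gamma / q * z))%:E)%E.
Proof.
move=> t0 te hz; apply: le_trans (F_smoothing _ _ t0) _.
rewrite lee_fin.
have D0 : 0 <= fine (Ldist mu q%:E u u') by rewrite fine_ge0// Ldist_ge0.
have hD : fine (Ldist mu q%:E u u') `^ gamma <= expR (gamma / q * z).
  have -> : gamma = q * (gamma / q) by field; rewrite gt_eqF.
  rewrite powRrM [q * _ / q]mulrAC divff ?gt_eqF// mul1r [_ / q * z]mulrC expRM.
  by apply: ge0_ler_powR; rewrite ?nnegrE ?powR_ge0 ?expR_ge0// divr_ge0// ltW.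
rewrite !expRD (lnK hc) -mulNr -powRE//.
apply: ler_pM => //; rewrite ?mulr_ge0 ?powR_ge0 ?expR_ge0 ?(ltW hc)//.
apply: ler_pM => //; rewrite ?mulr_ge0 ?powR_ge0 ?expR_ge0 ?(ltW hc)//.
by rewrite ler_expR.
Qed.

(** Induction on the number N of halvings. F_(t/2) is run on u and v; the difference of the images
    is clipped at L/4, which gives v2, and the induction hypothesis is applied at time t/2 and level
    L/2 to F_(t/2) u, F_(t/2) v and v2. The errors in L^oo add up to at most e^(omega t) (L/2 +
    L/2). *)
Lemma level_descent t L N u u' v : 0 < t -> 0 < L -> omega * beta * t <= eps ->
  (Ldist mu +oo u v <= (expR (eta - omega * t))%:E)%E ->
  fine (Ldist mu q%:E u v) `^ q <= expR (level_exponent (ln t) (ln L)) ->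
  (Ldist mu +oo u' v <= (L / 2)%:E)%E ->
  exists z : LspaceType mu q1,
    (Ldist mu +oo (F t u') z <= (expR (omega * t) * L)%:E)%E /\
    (Ldist mu r%:E (F t u) z
       <= (expR (decay_exponent (ln t - N%:R * l2) (ln L - N%:R * l2)))%:E)%E.
Proof.
have one_y : (1 <= +oo :> \bar R)%E by exact: leey.
have mL w := @Lspace_measurable _ _ _ mu q%:E q1 w.
elim: N t L u u' v => [|N IH] t L u u' v t0 L0 te uv huv u'v.
  exists (F t v); split; last first.
    by rewrite !mul0r !subr0; exact: F_smoothing_exp.
  apply: le_trans (F_contraction _ _ t0 one_y) _.
  apply: (@le_trans _ _ ((expR (omega * t))%:E * (L / 2)%:E)%E).
    by apply: lee_wpmul2l; rewrite ?lee_fin ?expR_ge0.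
  by rewrite -EFinM lee_fin ler_wpM2l ?expR_ge0// ler_pdivrMr//; lra.
have t20 : 0 < t / 2 by rewrite divr_gt0.
have L20 : 0 < L / 2 by rewrite divr_gt0.
have L40 : 0 < L / 2 / 2 by rewrite divr_gt0.
have te2 : omega * beta * (t / 2) <= eps.
  apply: le_trans te; rewrite ler_wpM2l ?mulr_ge0//; lra.
have ot0 : 0 <= omega * t by rewrite mulr_ge0// ltW.
(* The budget eta - omega t reserves the growth to come, so the bound recurs with t/2 in place of
   t. *)
have u1v1 : (Ldist mu +oo (F (t / 2) u) (F (t / 2) v) <= (expR (eta - omega * (t / 2)))%:E)%E.
  apply: le_trans (F_contraction _ _ t20 one_y) _.
  apply: (@le_trans _ _ ((expR (omega * (t / 2)))%:E * (expR (eta - omega * t))%:E)%E).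
    by apply: lee_wpmul2l; rewrite ?lee_fin ?expR_ge0.
  rewrite -EFinM lee_fin -expRD ler_expR; lra.
have hY := F_smoothing_exp t20 te2 huv.
set Y := expR _ in hY.
have [v2 [v1v2 u1v2 h2]] := Lspace_clip L40 (expR_gt0 _) u1v1.
have r1' : 1 <= r by rewrite -lee_fin.
have := h2 r delta Y r1' hdelta hrdelta (expR_ge0 _) hY.
rewrite (powRE _ L40) /Y -!expRM -!expRD => {}h2.
(* [level_exponent] uses eta throughout; the better bound eta - omega t/2 available here leaves the
   slack omega (t/2) (q - r + delta). *)
have {}h2 : fine (Ldist mu q%:E (F (t / 2) u) v2) `^ q <=
    expR (level_exponent (ln (t / 2)) (ln (L / 2))).
  apply: (le_trans h2); rewrite ler_expR.
  have oq : 0 <= omega * (t / 2) * (q - r + delta) by rewrite !mulr_ge0// ltW.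
  rewrite !ln_div ?posrE// -/l2 /level_exponent.
  rewrite -subr_ge0 [leRHS](_ : _ = omega * (t / 2) * (q - r + delta))//.
  rewrite /kappa; field.
  by rewrite mulN1r !gt_eqF ?subr_gt0.
have [z [hz1 hz2]] := IH _ _ _ _ _ t20 L20 te2 (le_trans u1v2 u1v1) h2 v1v2.
exists z; split.
  have tri := @Ldist_triangle _ _ _ mu +oo%E (F t v) (F t u') z one_y (mL _) (mL _) (mL _).
  apply: (le_trans tri).
  rewrite (_ : expR (omega * t) * L = expR (omega * t) * (L / 2) + expR (omega * t) * (L / 2)); last by field.
  rewrite EFinD; apply: leeD.
    apply: le_trans (F_contraction _ _ t0 one_y) _.
    by rewrite EFinM; apply: lee_wpmul2l; rewrite ?lee_fin ?expR_ge0.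
  rewrite (F_halves _ t0); apply: le_trans hz1 _.
  rewrite lee_fin ler_wpM2r ?(ltW L20)// ler_expR; lra.
rewrite (F_halves _ t0); apply: le_trans hz2 _.
rewrite lee_fin ler_expR le_eqVlt; apply/orP; left; apply/eqP.
rewrite !ln_div ?posrE// -/l2 -natr1.
by congr decay_exponent; ring.
Qed.

(** The exponent is affine and drops by [y] at each halving; [y] is positive because kappa / (kappa
    - 1) > 1. *)
Lemma cvg_decay (lt lL : R) :
  expR (decay_exponent (lt - n%:R * l2) (lL - n%:R * l2)) @[n --> \oo] --> 0.
Proof.
have l20 : 0 < l2 by rewrite ln_gt0// ltr1n.
pose y := l2 * ((r / (sigma * (kappa - 1)) + delta / (kappa - 1)) * (gamma / q) - sigma^-1).
have y0 : 0 < y.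
  rewrite mulr_gt0// subr_gt0.
  apply: (@lt_le_trans _ _ (r / (sigma * (kappa - 1)) * (gamma / q))).
    rewrite (_ : _ * _ = sigma^-1 * (kappa / (kappa - 1))); last first.
      by rewrite /kappa; field; rewrite mulN1r !gt_eqF ?subr_gt0.
    by rewrite ltr_pMr ?invr_gt0// ltr_pdivlMr// mul1r gtrBl.
  rewrite ler_wpM2r ?divr_ge0 ?(ltW hgamma) ?(ltW q0)// lerDl.
  by rewrite divr_ge0// ltW.
rewrite (_ : (fun n => _) = geometric (expR (decay_exponent lt lL)) (expR (- y))).
  by apply: cvg_geometric; rewrite ger0_norm ?expR_ge0// expR_lt1 oppr_lt0.
apply/funext => n; rewrite /geometric /= -expRM_natl -expRD; congr expR.
rewrite /decay_exponent /level_exponent /y; ring.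
Qed.

(** The points z of [level_descent] converge to F t u in L^r as N grows, while each stays within
    e^(omega t) L of F t u' in L^oo; lower semicontinuity concludes. *)
Lemma level_bound t L u u' v : 0 < t -> 0 < L -> omega * beta * t <= eps ->
  (Ldist mu +oo u v <= (expR (eta - omega * t))%:E)%E ->
  fine (Ldist mu q%:E u v) `^ q <= expR (level_exponent (ln t) (ln L)) ->
  (Ldist mu +oo u' v <= (L / 2)%:E)%E ->
  (Ldist mu +oo (F t u) (F t u') <= (expR (omega * t) * L)%:E)%E.
Proof.
move=> t0 L0 te uv huv u'v.
have mB := @measurable_LspaceB _ _ _ mu q%:E q1.
have H N := @level_descent t L N u u' v t0 L0 te uv huv u'v.
pose z N := sval (cid (H N)).
have hz N := svalP (cid (H N)).
have one_y : (1 <= +oo :> \bar R)%E by exact: leey.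
have r1' : 1 <= r by rewrite -lee_fin.
rewrite LdistC.
apply: (@Lnorm_lsc _ _ _ mu r +oo%E (fun N => (F t u' : X -> R) \- z N)) => //.
- have h : (expR (decay_exponent (ln t - n%:R * l2) (ln L - n%:R * l2)))%:E @[n --> \oo] --> 0%E.
    by apply: cvg_EFin; [exact: nearW|exact: cvg_decay].
  apply: (@squeeze_cvge _ _ _ _ (cst 0%E) _ _ _ _ _ h); last exact: cvg_cst.
  apply: nearW => n; rewrite Lnorm_ge0/=.
  rewrite (_ : (_ \- _) \- _ = (F t u : X -> R) \- z n); first exact: (hz n).2.
  by apply/funext => x /=; ring.
- by rewrite mulr_ge0 ?expR_ge0// ltW.
- move=> e e0; apply: nearW => n; apply: le_trans (hz n).1 _.
  by rewrite lee_fin lerDl ltW.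
Qed.

End levels.

(** L is chosen to put the clipped pair at the threshold of [level_bound]. Solving for L gives a
    product of powers of t, y and H, up to exponentials in t, with g the power of H. *)
Lemma ultracontractive_step (s delta : R) : (1 <= s%:E)%E -> 0 < delta ->
  0 <= q - r + delta -> 0 <= q - s + delta ->
  let g := 1 - ((kappa - 1) * (s - q) + (r - q)) / (kappa * delta) in
  exists K : R, forall t u u' (y H : R), 0 < t -> 0 < y -> 0 < H ->
    (Ldist mu s%:E u u' <= y%:E)%E -> (Ldist mu +oo u u' <= H%:E)%E ->
    (Ldist mu +oo (F t u) (F t u') <=
      (expR (K - r / (sigma * (kappa * delta)) * ln t
        + omega * (1 + g + r * beta / (kappa * delta)) * t
        + s * (kappa - 1) / (kappa * delta) * ln y + g * ln H))%:E)%E.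
Proof.
move=> s1 d0 qr qs g.
have s1' : 1 <= s by rewrite -lee_fin.
have k0 : 0 < kappa by rewrite divr_gt0 ?mulr_gt0.
(* The constant term of [level_exponent] as a function of eps. *)
pose z e := (- ((r / sigma + delta) / (kappa - 1) * l2) - r * ln c - r / sigma * l2
    - 2 * delta * l2 - r * e) / (kappa - 1).
exists ((kappa - 1) / (kappa * delta) * (delta * l2 - z 0)) => t u u' y H t0 y0 H0 hy hH.
(* [eta] bounds the logarithm of the L^oo-distance over the whole time t, and [eps] that of the
   exponential factor in the smoothing estimate. *)
pose eta := ln H + omega * t; pose eps := omega * beta * t.
(* [lam] = ln L solves the equality between the bound for clipping at L/2, with eta in place of ln
   H, and the threshold. *)
pose lam := (kappa - 1) / (kappa * delta) * (s * ln y + delta * l2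
  + (q - s + delta + (q - r + delta) / (kappa - 1)) * eta - z eps
  - r / (sigma * (kappa - 1)) * ln t).
have L20 : 0 < expR lam / 2 by rewrite divr_gt0 ?expR_gt0.
have [v [u'v uv hv]] := Lspace_clip L20 H0 hH.
have {}hv := hv s delta y s1' (ltW d0) qs (ltW y0) hy.
have kne : kappa - 1 != 0 by rewrite gt_eqF.
have kne' : kappa != 0 by rewrite gt_eqF.
have dne : delta != 0 by rewrite gt_eqF.
have sne : sigma != 0 by rewrite gt_eqF.
apply: le_trans (@level_bound delta eps eta (ltW d0) qr t (expR lam) u u' v t0 (expR_gt0 _) (lexx _) _ _ u'v) _.
- rewrite /eta addrK lnK ?posrE//; exact: le_trans uv hH.
- apply: (le_trans hv); rewrite !powRE// -!expRD ler_expR ln_div ?posrE ?expR_gt0// expRK -/l2.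
  have oq : 0 <= omega * t * (q - s + delta) by rewrite !mulr_ge0// ltW.
  rewrite -subr_ge0 [leRHS](_ : _ = omega * t * (q - s + delta))//.
  rewrite /level_exponent -/(z eps) /lam /eta; move: (z eps) kne kne' => ze; move: kappa => k kne kne'.
  by field; rewrite ?kne ?kne' ?dne ?sne.
- rewrite lee_fin -expRD ler_expR le_eqVlt; apply/orP; left; apply/eqP.
  rewrite /lam /g /eta /z /eps; move: kne kne'; move: kappa => k kne kne'.
  by field; rewrite ?kne ?kne' ?dne ?sne.
Qed.

End DeGiorgi.

(** * Removal of the L^oo-norm by splitting time *)

Section time_splitting.
Context d (X : measurableType d) (R : realType) (mu : {measure set X -> \bar R}).
Context (q : R) (q1 : (1 <= q%:E)%E) (omega : R) (homega : 0 <= omega).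
Context (F : R -> LspaceType mu q1 -> LspaceType mu q1).
Hypothesis F_contraction : forall t u u' (s : \bar R), 0 < t -> (1 <= s)%E ->
  (Ldist mu s (F t u) (F t u') <= (expR (omega * t))%:E * Ldist mu s u u')%E.
Hypothesis F_iter : forall t n u, 0 < t -> F (n.+1%:R * t) u = iter n.+1 (F t) u.
Context (s : \bar R) (s1 : (1 <= s)%E) (a b e g K1 B : R).
Hypotheses (ha : 0 <= a) (g0 : 0 <= g) (g1 : g < 1) (hB : 0 <= B) (heB : e < B * (1 - g)).
Implicit Types (u v : LspaceType mu q1) (t y H : R).
Hypothesis F_step : forall t u u' y H, 0 < t -> 0 < y -> 0 < H ->
  (Ldist mu s u u' <= y%:E)%E -> (Ldist mu +oo u u' <= H%:E)%E ->
  (Ldist mu +oo (F t u) (F t u') <=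
    (expR (K1 - a * ln t + omega * b * t + e * ln y + g * ln H))%:E)%E.

(** The step estimate is applied on a short final time lam x, after bounding the L^oo-distance at
    time rho x by the estimate itself; since g < 1, iterating forgets the initial H. *)
Lemma ultracontractive : exists K : R, forall t u u' y H, 0 < t -> 0 < y -> 0 < H ->
  (Ldist mu s u u' <= y%:E)%E -> (Ldist mu +oo u u' <= H%:E)%E ->
  (Ldist mu +oo (F t u) (F t u') <=
    (expR (K - a / (1 - g) * ln t + omega * B * t + e / (1 - g) * ln y))%:E)%E.
Proof.
have g1' : 0 < 1 - g by rewrite subr_gt0.
have gne : 1 - g != 0 by rewrite gt_eqF.
pose c0 := B * (1 - g) - e.
have c00 : 0 < c0 by rewrite subr_gt0.
(* Of M + 1 equal parts of the time, the last one runs at rate b; its extra cost lam |b - e - g B|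
   is at most c0, the room left by e < B (1 - g). M is positive so that [F_iter] covers the first M
   parts. *)
pose M := (Num.bound (`|b - e - g * B| / c0)).+1.
have M0 : (0 : R) < M.+1%:R by [].
have M0' : (0 : R) < M%:R by rewrite ltr0n.
pose lam : R := M.+1%:R^-1; pose rho : R := M%:R / M.+1%:R.
have lam0 : 0 < lam by rewrite invr_gt0.
have rho0 : 0 < rho by rewrite divr_gt0.
have lamrho : lam + rho = 1 by rewrite /lam /rho -natr1; field; rewrite natr1 gt_eqF.
have hlam : b * lam + e * rho + g * B * rho <= B.
  have hx : 0 <= `|b - e - g * B| / c0 by rewrite divr_ge0// ltW.
  have hb : `|b - e - g * B| / c0 < M.+1%:R.
    apply: (lt_trans (archi_boundP hx)); by rewrite ltr_nat /M ltnS leqnSn.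
  have : lam * `|b - e - g * B| <= c0.
    have hb' : `|b - e - g * B| <= M.+1%:R * c0 by rewrite -ler_pdivrMr// ltW.
    by rewrite [lam * _]mulrC /lam ler_pdivrMr// [leRHS]mulrC.
  have := ler_wpM2l (ltW lam0) (ler_norm (b - e - g * B)).
  rewrite /c0; have -> : rho = 1 - lam by rewrite -lamrho [lam + _]addrC addrK.
  move=> h1 h2; have := le_trans h1 h2; nra.
(* Solves K = K1 - a ln lam + g (K - a / (1 - g) ln rho). *)
pose K := (K1 - a * ln lam - g * (a / (1 - g)) * ln rho) / (1 - g).
have one_y : (1 <= +oo :> \bar R)%E by exact: leey.
exists K => t u u' y H t0 y0 H0 hy hH.
pose Phi x := K - a / (1 - g) * ln x + omega * B * x + e / (1 - g) * ln y.
have PhiS x : 0 < x -> K1 - a * ln (lam * x) + omega * b * (lam * x)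
    + e * (ln y + omega * (rho * x)) + g * Phi (rho * x) <= Phi x.
  move=> x0; rewrite /Phi (_ : ln (lam * x) = ln lam + ln x); last by rewrite lnM ?posrE.
  rewrite (_ : ln (rho * x) = ln rho + ln x); last by rewrite lnM ?posrE.
  rewrite -subr_ge0 [leRHS](_ : _ = omega * x * (B - (b * lam + e * rho + g * B * rho))).
    by apply: mulr_ge0; [apply: mulr_ge0 => //; exact: ltW|rewrite subr_ge0].
  rewrite /K; move: (ln lam) (ln rho) (ln x) (ln y) => *; field; exact: gne.
(* Bounds the excess of the trivial contraction bound over [Phi], uniformly for times x <= t because
   -ln x only grows as x decreases. *)
pose Q := `|ln H + omega * t - (K - a / (1 - g) * ln t + e / (1 - g) * ln y)|.
have Q0 : 0 <= Q by exact: normr_ge0.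
have base x : 0 < x -> x <= t -> ln H + omega * x <= Phi x + Q.
  move=> x0 xt.
  have h1 : omega * x <= omega * t by rewrite ler_wpM2l.
  have h2 : a / (1 - g) * ln x <= a / (1 - g) * ln t.
    by rewrite ler_wpM2l ?divr_ge0 ?(ltW g1')// ler_ln.
  have h3 : 0 <= omega * B * x by rewrite !mulr_ge0// ltW.
  have := ler_norm (ln H + omega * t - (K - a / (1 - g) * ln t + e / (1 - g) * ln y)).
  rewrite -/Q /Phi; lra.
(* [Phi] is a fixed point of the splitting, so the excess [Q] shrinks by a factor [g]. *)
have main k x : 0 < x -> x <= t ->
    (Ldist mu +oo (F x u) (F x u') <= (expR (Phi x + g ^+ k * Q))%:E)%E.
  elim: k x => [|k IH] x x0 xt.
    apply: le_trans (F_contraction _ _ x0 one_y) _.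
    apply: (@le_trans _ _ ((expR (omega * x))%:E * H%:E)%E).
      by apply: lee_wpmul2l; rewrite ?lee_fin ?expR_ge0.
    rewrite -EFinM lee_fin -[X in _ * X](@lnK _ H) ?posrE// -expRD ler_expR expr0 mul1r addrC.
    exact: base.
  have lx0 : 0 < lam * x by rewrite mulr_gt0.
  have rx0 : 0 < rho * x by rewrite mulr_gt0.
  have rxt : rho * x <= t.
    apply: le_trans xt; rewrite -[leRHS]mul1r ler_wpM2r ?(ltW x0)//.
    by rewrite -lamrho lerDr ltW.
  have split w : F x w = F (lam * x) (F (rho * x) w).
    have -> : F x w = F (M.+1%:R * (lam * x)) w.
      by congr F; rewrite mulrA /lam mulfV ?mul1r// gt_eqF.
    have -> : rho * x = (Num.bound (`|b - e - g * B| / c0)).+1%:R * (lam * x).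
      by rewrite /rho /lam mulrA.
    by rewrite !F_iter.
  rewrite !split.
  apply: le_trans (F_step lx0 (_ : 0 < y * expR (omega * (rho * x)))
    (expR_gt0 (Phi (rho * x) + g ^+ k * Q)) _ (IH _ rx0 rxt)) _.
  - by rewrite mulr_gt0// expR_gt0.
  - apply: le_trans (F_contraction _ _ rx0 s1) _.
    rewrite [y * _]mulrC EFinM; apply: lee_wpmul2l => //; by rewrite lee_fin expR_ge0.
  have -> : ln (y * expR (omega * (rho * x))) = ln y + omega * (rho * x).
    by rewrite lnM ?posrE ?expR_gt0// expRK.
  rewrite lee_fin ler_expR expRK.
  have := PhiS x x0; rewrite exprS; lra.
have cv : (expR (Phi t + g ^+ k * Q))%:E @[k --> \oo] --> (expR (Phi t))%:E.
  apply: cvg_EFin; first exact: nearW.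
  apply: continuous_cvg; first exact: continuous_expR.
  rewrite -[X in _ --> X]addr0; apply: cvgD; first exact: cvg_cst.
  rewrite (_ : (fun k => _) = geometric Q g); last by apply/funext => k; rewrite /= mulrC.
  by apply: cvg_geometric; rewrite ger0_norm.
by apply: (cvge_to_ge cv); apply: nearW => k; exact: main.
Qed.

End time_splitting.

(** * Extension by density and conclusion *)

Section band.
Context {R : realType}.

(** Small values are cut off as well as large ones, so that an L^s-function becomes an L^q-function
    for either order of q and s. *)
Definition band (n : nat) (x : R) : R :=
  if n.+1%:R^-1 <= `|x| then (if `|x| <= n.+1%:R then x else 0) else 0.

Lemma norm_band n x : `|band n x| <= n.+1%:R.
Proof. by rewrite /band; case: ifP => _; [case: ifP|]; rewrite ?normr0. Qed.

Lemma norm_band_le n x : `|band n x| <= `|x|.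
Proof. by rewrite /band; case: ifP => _; [case: ifP|]; rewrite ?normr0. Qed.

Lemma norm_band_sub_le n x : `|band n x - x| <= `|x|.
Proof.
by rewrite /band; case: ifP => _; [case: ifP|]; rewrite ?subrr ?normr0// sub0r normrN.
Qed.

Lemma cvg_band x : band n x @[n --> \oo] --> x.
Proof.
have [->|x0] := eqVneq x 0.
  rewrite (_ : (fun n => _) = cst 0); first exact: cvg_cst.
  by apply/funext => n; rewrite /band if_same; case: ifP.
apply: cvg_near_cst; near=> n; rewrite /band.
have -> : n.+1%:R^-1 <= `|x|.
  rewrite -[leRHS]invrK lef_pV2 ?posrE ?invr_gt0 ?normr_gt0//.
  by rewrite -natr1 ler_wpDr//; near: n; exact: nbhs_infty_ger.
have -> // : `|x| <= n.+1%:R.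
by rewrite -natr1 ler_wpDr//; near: n; exact: nbhs_infty_ger.
Unshelve. all: by end_near.
Qed.

Lemma norm_band_powR n x q s : 0 < q ->
  `|band n x| `^ q <= n.+1%:R `^ `|q - s| * `|x| `^ s.
Proof.
move=> q0; rewrite /band.
have N0 : (0 : R) < n.+1%:R by [].
have z0 : `|0 : R| `^ q <= n.+1%:R `^ `|q - s| * `|x| `^ s.
  by rewrite normr0 powR0 ?gt_eqF// mulr_ge0 ?powR_ge0.
case: ifP => // xn; case: ifP => // xn'.
have x0 : 0 < `|x| by apply: lt_le_trans xn; rewrite invr_gt0.
have -> : `|x| `^ q = `|x| `^ (q - s) * `|x| `^ s.
  by rewrite -powRD ?(gt_eqF x0) ?implybT// subrK.
apply: ler_wpM2r; first exact: powR_ge0.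
have [qs|/ltW qs] := leP 0 (q - s).
  by rewrite (ger0_norm qs); apply: (ge0_ler_powR qs) => //; rewrite nnegrE ltW.
rewrite (ler0_norm qs).
have -> : `|x| `^ (q - s) = `|x|^-1 `^ (- (q - s)).
  by rewrite -powR_inv1 ?ltW// -powRrM mulN1r opprK.
have p0 : 0 <= - (q - s) by rewrite oppr_ge0.
apply: (ge0_ler_powR p0); rewrite ?nnegrE ?invr_ge0 ?(ltW N0)//.
by rewrite -[leRHS]invrK lef_pV2 ?posrE ?invr_gt0.
Qed.

Lemma measurable_band d (T : measurableType d) n (f : T -> R) :
  measurable_fun setT f -> measurable_fun setT (fun y => band n (f y)).
Proof.
move=> mf; have m0 c : measurable_fun setT (fun=> c : R) by exact: measurable_cst.
have mn : measurable_fun setT (fun y => `|f y|) by exact: measurableT_comp.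
by apply: measurable_fun_ifT => //; [exact: measurable_fun_ler|
  apply: measurable_fun_ifT => //; exact: measurable_fun_ler].
Qed.

End band.

Section density.
Context d (T : measurableType d) (R : realType) (mu : {measure set T -> \bar R}).
Context (q s : R) (q1 : (1 <= q%:E)%E) (s1 : (1 <= s%:E)%E).

Lemma cvg_Lnorm_band (f : T -> R) : measurable_fun setT f -> finite_norm mu s%:E f ->
  'N[mu]_s%:E[EFin \o (fun x => band n (f x) - f x)%R]%E @[n --> \oo] --> 0%E.
Proof.
move=> mf ff.
have s1' : 1 <= s by rewrite -lee_fin.
have s0 : 0 < s by exact: lt_le_trans s1'.
pose F n x := (`|band n (f x) - f x| `^ s)%:E.
have mF n : measurable_fun setT (F n).
  by apply: measurable_abs_powR; apply: measurable_funB => //; exact: measurable_band.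
have Fcv x : setT x -> F n x @[n --> \oo] --> cst 0%E x.
  move=> _; apply: cvg_EFin; first exact: nearW.
  rewrite (_ : 0 = `|f x - f x| `^ s); last by rewrite subrr normr0 powR0// gt_eqF.
  apply: (@continuous_cvg _ _ _ _ _ (fun n => band n (f x) - f x) (fun y : R => `|y| `^ s)).
    exact: continuous_abs_powR.
  by apply: cvgB; [exact: cvg_band|exact: cvg_cst].
have Fle n x : setT x -> (`|F n x| <= (`|f x| `^ s)%:E)%E.
  move=> _; rewrite gee0_abs ?lee_fin ?powR_ge0//.
  by apply: (ge0_ler_powR (ltW s0)); rewrite ?nnegrE//; exact: norm_band_sub_le.
have Gfin x : setT x -> (`|f x| `^ s)%:E \is a fin_num by [].
have := @dominated_cvg _ _ _ mu setT measurableT F (cst 0%E) _ mF Fcv Gfin (integrable_powR s1' mf ff) Fle.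
rewrite integral0 => /fine_cvgP [Hf Hc].
have e n : ('N[mu]_s%:E[EFin \o (fun x => band n (f x) - f x)%R] = (\int[mu]_x F n x) `^ s^-1)%E.
  exact: LnormE.
under eq_fun do rewrite e.
apply/fine_cvgP; split; first by apply: filterS Hf => n; exact: fin_num_poweR.
rewrite (_ : fine \o _ = (fun n => `|fine (\int[mu]_x F n x)| `^ s^-1)); last first.
  apply/funext => n; rewrite /= fine_poweR ger0_norm// fine_ge0//.
  exact: integral_powR_ge0.
rewrite (_ : 0 = `|0 : R| `^ s^-1); last by rewrite normr0 powR0// invr_eq0 gt_eqF.
apply: (@continuous_cvg _ _ _ _ _ (fun n => fine (\int[mu]_x F n x)) (fun y : R => `|y| `^ s^-1)) => //.
by apply: continuous_abs_powR; rewrite invr_gt0.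
Qed.

(** [v] and [w] are one function seen in L^q and in L^s; its boundedness provides the finite
    L^oo-distance on which the estimates rest. *)
Lemma Lspace_approx (u : LspaceType mu s1) :
  exists (v : nat -> LspaceType mu q1) (w : nat -> LspaceType mu s1),
  [/\ forall n, (v n : T -> R) = (w n : T -> R) %[ae mu],
      forall n, \forall x \ae mu, `|v n x| <= n.+1%:R &
      Ldist mu s%:E (w n) u @[n --> \oo] --> 0%E].
Proof.
have mu_ := Lspace_measurable u.
have mb n : measurable_fun setT (fun x => band n (u x)) by exact: measurable_band.
have fs n : finite_norm mu s%:E (fun x => band n (u x)).
  apply: le_lt_trans (Lspace_finite u); apply: le_Lnorm => //.
  by apply: nearW => x; exact: norm_band_le.
have q0 : 0 < q by rewrite -lte_fin (lt_le_trans _ q1).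
have fq n : finite_norm mu q%:E (fun x => band n (u x)).
  rewrite /finite_norm LnormE; apply: poweR_lty.
  pose K : R := n.+1%:R `^ `|q - s|.
  apply: (@le_lt_trans _ _ (\int[mu]_x (K%:E * (`|u x| `^ s)%:E))%E).
    apply: ge0_le_integral => //.
    - exact: measurable_abs_powR.
    - by apply: measurable_funeM; exact: measurable_abs_powR.
    - by move=> x _; rewrite -EFinM lee_fin; exact: norm_band_powR.
  rewrite ge0_integralZl_EFin ?powR_ge0//; last exact: measurable_abs_powR.
  apply: lte_mul_pinfty; rewrite ?lee_fin ?powR_ge0//.
  have s0 : s != 0 by rewrite gt_eqF// -lte_fin (lt_le_trans _ s1).
  by rewrite -Lnorm_powR//; apply: poweR_lty; exact: Lspace_finite.
pose v n := sval (cid (Lspace_surj q1 (mb n) (fq n))).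
pose w n := sval (cid (Lspace_surj s1 (mb n) (fs n))).
have hv n := svalP (cid (Lspace_surj q1 (mb n) (fq n))).
have hw n := svalP (cid (Lspace_surj s1 (mb n) (fs n))).
exists v, w; split.
- by move=> n; apply: filterS2 (hv n) (hw n) => x h1 h2 _; rewrite /v /w h1// h2.
- by move=> n; apply: filterS (hv n) => x h1; rewrite /v h1//; exact: norm_band.
rewrite (_ : (fun n => _) = (fun n => 'N[mu]_s%:E[EFin \o (fun x => band n (u x) - u x)%R]%E)).
  by apply: cvg_Lnorm_band => //; exact: Lspace_finite.
apply/funext => n; apply: Lnorm_ae => //.
- exact: measurable_LspaceB.
- exact: measurable_funB.
- by apply: filterS (hw n) => x h1 _ /=; rewrite /w h1.
Qed.

End density.

Section extension.
Context d (T : measurableType d) (R : realType) (mu : {measure set T -> \bar R}).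
Context (q s : R) (q1 : (1 <= q%:E)%E) (s1 : (1 <= s%:E)%E).
Context (F : LspaceType mu q1 -> LspaceType mu q1) (G : LspaceType mu s1 -> LspaceType mu s1).
Context (k g : R).
Hypotheses (FG : Lipschitz_extension F G) (g0 : 0 < g).
Hypothesis F_bound : forall (u u' : LspaceType mu q1) (y H : R), 0 < y -> 0 < H ->
  (Ldist mu s%:E u u' <= y%:E)%E -> (Ldist mu +oo u u' <= H%:E)%E ->
  (Ldist mu +oo (F u) (F u') <= (expR (k + g * ln y))%:E)%E.

(** The right-hand side of [F_bound] does not depend on H, so it holds along bounded approximants
    with H = 2 (n + 1), and passes to the limit by continuity of [G] in L^s and lower
    semicontinuity. *)
Lemma Lipschitz_extension_bound (u u' : LspaceType mu s1) :
  (Ldist mu +oo (G u) (G u') <= (expR k * fine (Ldist mu s%:E u u') `^ g)%:E)%E.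
Proof.
have [[L GL] FGe] := FG.
have [v [w [vw vb wu]]] := Lspace_approx q1 u.
have [v' [w' [vw' vb' wu']]] := Lspace_approx q1 u'.
have one_y : (1 <= +oo :> \bar R)%E by exact: leey.
have mq a := @Lspace_measurable _ _ _ mu q%:E q1 a.
have ms a := @Lspace_measurable _ _ _ mu s%:E s1 a.
set Y := fine (Ldist mu s%:E u u').
have Y0 : 0 <= Y by rewrite fine_ge0// Ldist_ge0.
have Gcv (a : nat -> LspaceType mu s1) (b : LspaceType mu s1) : Ldist mu s%:E (a n) b @[n --> \oo] --> 0%E ->
    Ldist mu s%:E (G (a n)) (G b) @[n --> \oo] --> 0%E.
  move=> ab.
  have h : (L%:E * Ldist mu s%:E (a n) b)%E @[n --> \oo] --> 0%E.
    by rewrite -[X in _ --> X](mule0 L%:E); apply: cvgeZl.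
  apply: (@squeeze_cvge _ _ _ _ (cst 0%E) _ _ _ _ _ h); last exact: cvg_cst.
  by apply: nearW => n; rewrite Ldist_ge0 /=.
(* The margin e keeps y positive, as its logarithm requires, and absorbs the approximation errors;
   it tends to 0 at the end, where g > 0 gives continuity even if Y = 0. *)
have step e : 0 < e -> (Ldist mu +oo (G u) (G u') <= (expR k * (Y + e) `^ g)%:E)%E.
  move=> e0.
  have Ye0 : 0 < Y + e by rewrite ltr_wpDl.
  have eE : expR k * (Y + e) `^ g = expR (k + g * ln (Y + e)) by rewrite expRD powRE.
  apply: (Ldist_lsc one_y (Gcv _ _ wu) (Gcv _ _ wu')); first by rewrite mulr_ge0 ?expR_ge0 ?powR_ge0.
  move=> e' e'0; have e20 : 0 < e / 2 by rewrite divr_gt0.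
  have small (a : nat -> LspaceType mu s1) (b : LspaceType mu s1) : Ldist mu s%:E (a n) b @[n --> \oo] --> 0%E ->
      \forall n \near \oo, (Ldist mu s%:E (a n) b <= (e / 2)%:E)%E.
    move=> /fine_cvgP [fin /cvgr_le /(_ _ e20)].
    by apply: filterS2 fin => n /fineK <-; rewrite lee_fin.
  have sw := small _ _ wu; have sw' := small _ _ wu'.
  near=> n.
  have dn : (Ldist mu s%:E (w n) u <= (e / 2)%:E)%E by near: n; exact: sw.
  have dn' : (Ldist mu s%:E (w' n) u' <= (e / 2)%:E)%E by near: n; exact: sw'.
  have -> : Ldist mu +oo (G (w n)) (G (w' n)) = Ldist mu +oo (F (v n)) (F (v' n)).
    by apply: Ldist_ae => //; apply: ae_eq_sym; exact: FGe.
  apply: (@le_trans _ _ (expR (k + g * ln (Y + e)))%:E); last first.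
    by rewrite eE lee_fin lerDl ltW.
  apply: (F_bound Ye0 (_ : 0 < n.+1%:R + n.+1%:R)) => //.
    rewrite (@Ldist_ae _ _ _ mu s%:E _ _ (w n) (w' n))//.
    have tri1 := @Ldist_triangle _ _ _ mu s%:E u (w n) (w' n) s1 (ms _) (ms _) (ms _).
    have tri2 := @Ldist_triangle _ _ _ mu s%:E u' u (w' n) s1 (ms _) (ms _) (ms _).
    apply: (le_trans tri1).
    rewrite (_ : Y + e = e / 2 + (Y + e / 2)); last by field.
    rewrite EFinD; apply: leeD => //; apply: (le_trans tri2).
    by rewrite EFinD Ldist_fineK LdistC; apply: leeD => //; rewrite LdistC.
  apply/Lnormy_leP => //.
  apply: filterS2 (vb n) (vb' n) => x h h' /=.
  by apply: (le_trans (ler_normB _ _)); exact: lerD.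
have cv : (expR k * (Y + n.+1%:R^-1) `^ g)%:E @[n --> \oo] --> (expR k * Y `^ g)%:E.
  apply: cvg_EFin; first exact: nearW.
  apply: cvgM; first exact: cvg_cst.
  rewrite (_ : (fun n => _) = fun n => `|Y + n.+1%:R^-1| `^ g); last first.
    by apply/funext => n /=; rewrite ger0_norm// addr_ge0.
  rewrite -{2}(ger0_norm Y0).
  apply: (@continuous_cvg _ _ _ _ _ (fun n => Y + n.+1%:R^-1) (fun y : R => `|y| `^ g)).
    exact: continuous_abs_powR.
  rewrite -[X in _ --> X]addr0; apply: cvgD; first exact: cvg_cst.
  exact: cvg_harmonic.
by apply: (cvge_to_ge cv); apply: nearW => n; apply: step; rewrite invr_gt0.
Unshelve. all: by end_near.
Qed.

End extension.

(** The numerator is gamma k - 1 + D. If k < gamma then gamma k > 1. Otherwise m0 >= q / gamma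
    yields D >= k / gamma - 1, and gamma + 1 / gamma >= 2 gives at least 2 (k - 1). *)
Lemma betastar_gt0 (R : realType) (q gamma r m0 : R) : 1 <= q -> 0 < gamma ->
  q < gamma * r -> q * gamma^-1 <= m0 ->
  let D := (gamma * r / q - 1) * m0 + q * (gamma^-1 - 1) in
  0 < D -> 0 < (gamma ^+ 2 * r * q^-1 - 1) / D + 1.
Proof.
move=> q1 g0 gr m0q D D0.
have q0 : 0 < q by lra.
set k := gamma * r / q in D D0 *.
have k1 : 1 < k by rewrite ltr_pdivlMr// mul1r.
have -> : gamma ^+ 2 * r * q^-1 = gamma * k by rewrite /k; ring.
have -> : (gamma * k - 1) / D + 1 = (gamma * k - 1 + D) / D.
  by rewrite [RHS]mulrDl divff// gt_eqF.
rewrite divr_gt0//.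
have [kg|gk] := ltP k gamma.
  have gk1 : 1 < gamma * k by nra.
  by rewrite addr_gt0// subr_gt0.
have h1 : (k - 1) * (q * gamma^-1) <= (k - 1) * m0 by rewrite ler_wpM2l//; lra.
have gi : gamma * gamma^-1 = 1 by rewrite mulfV// gt_eqF.
have gi0 : 0 < gamma^-1 by rewrite invr_gt0.
have h2 : 1 <= k * gamma^-1 by rewrite ler_pdivlMr// mul1r.
have h3 : k * gamma^-1 - 1 <= q * (k * gamma^-1 - 1) by rewrite ler_peMl// subr_ge0.
have h4 : 2 <= gamma + gamma^-1.
  have : 0 <= (gamma - 1) ^+ 2 * gamma^-1 by rewrite mulr_ge0 ?sqr_ge0// ltW.
  rewrite (_ : _ * _ = gamma + gamma^-1 - 2); first by lra.
  by field; rewrite gt_eqF.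
have h5 : 2 * k <= k * (gamma + gamma^-1) by rewrite mulrC ler_wpM2l//; lra.
rewrite /D; clear D D0; nra.
Qed.

(** The product den D equals E q / (gamma r), which is free of m0: the exponents reduce to the
    quantities that the De Giorgi step produces. *)
Lemma smoothing_exponents (R : realType) (q gamma r m0 sigma s : R) :
  1 <= q -> 0 < gamma -> 0 < sigma -> q < gamma * r -> q * gamma^-1 <= m0 -> 0 < s ->
  let D := (gamma * r / q - 1) * m0 + q * (gamma^-1 - 1) in
  0 < D ->
  let alphastar := sigma^-1 * q * gamma^-1 / D in
  let betastar := (gamma ^+ 2 * r * q^-1 - 1) / D + 1 in
  let gammastar := (gamma * r * q^-1 - 1) * m0 / D in
  let theta := s * q / (gamma * r * m0) in
  gammastar * (1 - theta) < 1 ->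
  let den := 1 - gammastar * (1 - theta) in
  let E := (gamma * r / q - 1) * (s - q) + (r - q) in
  [/\ 0 < E, alphastar / den = r / (sigma * E),
      gammastar * theta / den = (gamma * r / q - 1) * s / E &
      gammastar * theta / den < (betastar * 2^-1 + gammastar * theta) / den].
Proof.
move=> q1 g0 sg0 gr m0q s0 D D0 alphastar betastar gammastar theta h den E.
have q0 : 0 < q by lra.
have r0 : 0 < r by rewrite -(pmulr_rgt0 _ g0) (lt_trans q0).
have m00 : 0 < m0 by apply: lt_le_trans m0q; rewrite divr_gt0.
have den0 : 0 < den by rewrite subr_gt0.
have gr0 : 0 < gamma * r by rewrite mulr_gt0.
have [qn gn rn mn sn] : [/\ q != 0, gamma != 0, r != 0, m0 != 0 & sigma != 0].
  by split; rewrite gt_eqF.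
have denD : den * D = E * q / (gamma * r).
  have -> : den * D = D - (gamma * r * q^-1 - 1) * m0 * (1 - theta).
    by rewrite /den /gammastar mulrBl mul1r mulrAC divfK// gt_eqF.
  by rewrite /D /theta /E; field; rewrite qn gn rn mn.
have E0 : 0 < E.
  have : 0 < den * D by rewrite mulr_gt0.
  by rewrite denD pmulr_lgt0 ?invr_gt0// pmulr_lgt0.
have iden : den^-1 = D * (gamma * r) / (E * q).
  apply: (@mulfI _ den); rewrite ?gt_eqF// mulfV ?gt_eqF//.
  rewrite !mulrA denD; clearbody E; field; by rewrite gn rn qn gt_eqF.
split => //.
- rewrite iden /alphastar; move: D D0 {denD iden den den0 h gammastar betastar} @alphastar => D D0 _.
  by field; rewrite sn qn gn !gt_eqF.
- rewrite iden /gammastar /theta; move: D D0 {denD iden den den0 h gammastar betastar} @alphastar => D D0 _.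
  by field; rewrite rn mn qn gn !gt_eqF.
- rewrite ltr_pM2r ?invr_gt0// ltrDr mulr_gt0//.
  exact: betastar_gt0.
Qed.

Theorem theorem1p2 (d : measure_display) (X : measurableType d) (R : realType)
    (mu : {sigma_finite_measure set X -> \bar R})
    (q : R) (q1 : (1 <= q%:E)%E) (omega : R) (homega : 0 <= omega)
    (A : Lop mu q1)
    (hdense : Lclosure (Ldom A) = setT)
    (hA : m_completely_accretive (Lshift A omega))
    (r : \bar R) (r1 : (1 <= r)%E) (rho sigma C : R)
    (hrho : 0 <= rho) (hsigma : 0 < sigma) (hC : 0 < C)
    (hGN : forall u v u' v' : LspaceType mu q1, A (u, v) -> A (u', v') ->
       (Ldist mu r u u' `^ sigma
        <= (C * (qbracket mu q (u \- u') (v \- v')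
                 + omega * fine (Ldist mu q%:E u u') `^ q)
            * fine (Ldist mu q%:E u u') `^ rho)%:E)%E)
    (S : R -> LspaceType mu q1 -> LspaceType mu q1)
    (hS : semigroup_generated A S) :
  let alpha := sigma^-1 in
  let gamma := (q + rho) / sigma in
  let beta := gamma + 1 in
  (forall (t : R) (u u' : LspaceType mu q1), 0 < t ->
     (Ldist mu r (S t u) (S t u')
      <= ((C / q) `^ sigma^-1 * t `^ (- alpha) * expR (omega * beta * t)
          * fine (Ldist mu q%:E u u') `^ gamma)%:E)%E)
  /\
  (forall rr : R, r = rr%:E -> q < gamma * rr ->
     (exists u0 v0 : LspaceType mu q1,
        [/\ A (u0, v0), (v0 : X -> R) = cst 0 %[ae mu],
            finite_norm mu 1%E u0 & finite_norm mu +oo%E u0]) ->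
   forall m0 : R, q * gamma^-1 <= m0 ->
     let D := (gamma * rr / q - 1) * m0 + q * (gamma^-1 - 1) in
     0 < D ->
     let alphastar := sigma^-1 * q * gamma^-1 / D in
     let betastar := (gamma ^+ 2 * rr * q^-1 - 1) / D + 1 in
     let gammastar := (gamma * rr * q^-1 - 1) * m0 / D in
   forall (s : R) (s1 : (1 <= s%:E)%E), s <= gamma * rr * q^-1 * m0 ->
     let theta := s * q / (gamma * rr * m0) in
     gammastar * (1 - theta) < 1 ->
     let alphas := alphastar / (1 - gammastar * (1 - theta)) in
     let betas := (betastar * 2^-1 + gammastar * theta)
                  / (1 - gammastar * (1 - theta)) in
     let gammas := gammastar * theta / (1 - gammastar * (1 - theta)) in
   forall Ss : R -> LspaceType mu s1 -> LspaceType mu s1,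
     (forall t : R, 0 <= t -> Lipschitz_extension (S t) (Ss t)) ->
   exists K : R, forall (t : R) (u u' : LspaceType mu s1), 0 < t ->
     (Ldist mu +oo (Ss t u) (Ss t u')
      <= (K * t `^ (- alphas) * expR (omega * betas * t)
          * fine (Ldist mu s%:E u u') `^ gammas)%:E)%E).
Proof.
have q1' : 1 <= q by rewrite -lee_fin.
have q0 : 0 < q by exact: lt_le_trans q1'.
move=> alpha gamma beta.
have gamma0 : 0 < gamma by rewrite divr_gt0// ltr_wpDr.
have smooth := semigroup_smoothing homega hA.1 hdense hS r1 hrho hsigma hC hGN.
split => [t u u' t0|rr rE qgr _ m0 m0q D D0 alphastar betastar gammastar s s1 sle theta hth
  alphas betas gammas Ss SsE].
  exact: smooth.
have s1' : 1 <= s by rewrite -lee_fin.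
have s0 : 0 < s by exact: lt_le_trans s1'.
have [E0 ea eg hbg] := smoothing_exponents q1' gamma0 hsigma qgr m0q s0 D0 hth.
set kappa := gamma * rr / q in E0 ea eg.
set E := (kappa - 1) * (s - q) + (rr - q) in E0 ea eg.
have k1 : 1 < kappa by rewrite ltr_pdivlMr// mul1r.
have k0 : 0 < kappa by exact: lt_trans k1.
rewrite -/alphas in ea; rewrite -/gammas in eg hbg; rewrite -/betas in hbg.
have gs0 : 0 < gammas by rewrite eg divr_gt0// mulr_gt0// subr_gt0.
subst r.
(* Large enough that q - rr + delta and q - s + delta are nonnegative and E <= delta <= kappa delta,
   which yields 0 <= g. *)
pose delta := `|rr - q| + `|s - q| + E + 1.
have d0 : 0 < delta by rewrite ltr_wpDl// addr_ge0 ?(ltW E0)// addr_ge0.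
have n1 : 0 <= `|rr - q| by []. have n2 : 0 <= `|s - q| by [].
have qr : 0 <= q - rr + delta.
  by have := ler_norm (rr - q); rewrite /delta; clear -E0 n1 n2; lra.
have qs : 0 <= q - s + delta.
  by have := ler_norm (s - q); rewrite /delta; clear -E0 n1 n2; lra.
have c0 : 0 < (C / q) `^ sigma^-1 by rewrite powR_gt0// divr_gt0.
have beta0 : 0 <= beta by rewrite addr_ge0// ltW.
have contr := semigroup_contraction homega hA.1 hdense hS.
have iter_S := semigroup_iter homega hA.1 hdense hS.
have [K1 step] := ultracontractive_step r1 hsigma gamma0 homega beta0 c0 qgr smooth
  (fun t u u' s' t0 s1 => contr t u u' s' t0 s1) (fun t n u t0 => iter_S t n u t0) s1 d0 qr qs.
rewrite -/kappa -/E in step.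
set g := 1 - E / (kappa * delta) in step.
have kd0 : 0 < kappa * delta by rewrite mulr_gt0.
have Ekd : E <= kappa * delta.
  apply: (@le_trans _ _ delta); first by rewrite /delta; clear -n1 n2; lra.
  by rewrite ler_peMl ?ltW.
have g0 : 0 <= g by rewrite subr_ge0 ler_pdivrMr// mul1r.
have g1 : g < 1 by rewrite gtrBl divr_gt0.
have g1E : 1 - g = E / (kappa * delta) by rewrite /g subKr.
have a0 : 0 <= rr / (sigma * (kappa * delta)).
  apply: divr_ge0; last by apply: mulr_ge0; exact: ltW.
  by rewrite (le_trans ler01)// -lee_fin.
have B0 : 0 <= betas by rewrite ltW// (lt_trans gs0).
have [En kn dn sn] : [/\ E != 0, kappa != 0, delta != 0 & sigma != 0].
  by split; rewrite gt_eqF.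
(* Dividing by 1 - g = E / (kappa delta) removes delta from the exponents. *)
have eE : s * (kappa - 1) / (kappa * delta) = gammas * (1 - g).
  by rewrite g1E eg; clearbody kappa E delta; field; rewrite En kn dn.
(* The strict inequality gammas < betas is the room that the time splitting needs for the rate
   betas. *)
have eB : s * (kappa - 1) / (kappa * delta) < betas * (1 - g).
  by rewrite eE ltr_pM2r// subr_gt0.
have [K2 ultra] := ultracontractive homega
  (fun t u u' s' t0 s1 => contr t u u' s' t0 s1) (fun t n u t0 => iter_S t n u t0)
  s1 a0 g0 g1 B0 eB step.
have gn : 1 - g != 0 by rewrite gt_eqF// subr_gt0.
have ea' : rr / (sigma * (kappa * delta)) / (1 - g) = alphas.
  by rewrite g1E ea; clearbody kappa E delta; field; rewrite En kn dn sn.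
rewrite eE ea' mulfK// in ultra.
exists (expR K2) => t u u' t0.
have bound := @Lipschitz_extension_bound _ _ _ mu q s q1 s1 (S t) (Ss t)
  (K2 - alphas * ln t + omega * betas * t) gammas (SsE t (ltW t0)) gs0.
apply: (le_trans (bound (fun v v' y H y0 H0 hy hH => ultra t v v' y H t0 y0 H0 hy hH) u u')).
by rewrite lee_fin !expRD -mulNr -powRE.
Qed.
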